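(* Let $n\ge 2$, $0<a<1$, let $A=\{x\in\mathbb{R}^n:\ a<|x|<1\}$ and let $R_A$ be the corresponding Robin function. Then $R_A$ is radial, i.e. $R_A(x)=R_A(r)$ with $r=|x|$, and the function $r\mapsto R_A(r)$ has a unique critical point $r_0$ in $(a,1)$, which satisfies $R_A''(r_0)<0$.
   Context: The Green function $G_A$ of $-\Delta$ in $A$ with Dirichlet boundary conditions is defined, for $y\in A$, by $-\Delta_x G_A(x,y)=\delta_y(x)$ in $A$ and $G_A(x,y)=0$ for $x\in\partial A$. For $n\ge3$ it is written $G_A(x,y)=\frac{1}{(n-2)\omega_{n-1}|x-y|^{n-2}}+H(x,y)$, where $\omega_{n-1}$ is the surface area of the unit sphere of $\mathbb{R}^n$; for $n=2$ it is written $G_A(x,y)=-\frac{1}{2\pi}\log|x-y|+H(x,y)$. In both cases $H$ is smooth on $A\times A$ and harmonic in each variable. The Robin function is $R_A(x)=H(x,x)$. Primes denote derivatives with respect to $r$. *)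

(* Defs.v *)
From HB Require Import structures.
From mathcomp Require Import all_boot all_order all_algebra.
From mathcomp Require Import all_classical all_reals all_analysis.

Set Implicit Arguments.
Unset Strict Implicit.
Unset Printing Implicit Defensive.
Import Order.TTheory GRing.Theory Num.Theory.
Import numFieldNormedType.Exports.

Local Open Scope classical_set_scope.
Local Open Scope ring_scope.

(* Lebesgue measure on R^n.  The library puts the product sigma-algebra on
   n.-tuple R but no measurable structure on 'rV[R]_n, so the measure lives on
   tuples and [row_of_tuple] transports to row vectors.  The dimension n.+1
   measure is the image under (t, x) |-> t :: x of the product of the Lebesgue
   measure on R with the dimension n one. *)
Section LebesgueMeasure.
Variable R : realType.
Local Notation tupleR n := (n.-tuple (measurableTypeR R)).

Definition tuple_cons n (p : measurableTypeR R * tupleR n) : tupleR n.+1 :=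
  [the n.+1.-tuple _ of p.1 :: p.2].

Lemma measurable_tuple_cons n : measurable_fun [set: _] (@tuple_cons n).
Proof.
by apply: measurable_cons; [exact: measurable_fst|exact: measurable_snd].
Qed.

Section Step.
Variables (n : nat) (mu : {sigma_finite_measure set (tupleR n) -> \bar R}).

Definition lebesgue_step : set (tupleR n.+1) -> \bar R :=
  pushforward ((@lebesgue_measure R) \x mu)%E (@tuple_cons n).

Let step0 : lebesgue_step set0 = 0%E.
Proof. by rewrite /lebesgue_step /pushforward preimage_set0 measure0. Qed.

Let step_ge0 A : (0 <= lebesgue_step A)%E.
Proof. by rewrite /lebesgue_step /pushforward; exact: measure_ge0. Qed.

Let step_sigma_additive : semi_sigma_additive lebesgue_step.
Proof.
have mpre B : measurable B -> measurable (@tuple_cons n @^-1` B).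
  by move=> mB; rewrite -[X in measurable X]setTI; exact: measurable_tuple_cons.
move=> F mF tF mUF; rewrite /lebesgue_step /pushforward preimage_bigcup.
apply: measure_semi_sigma_additive; first by move=> k; exact: mpre.
- apply/trivIsetP => /= i j _ _ ij; rewrite -preimage_setI.
  by move/trivIsetP : tF => /(_ _ _ _ _ ij) ->//; rewrite preimage_set0.
- by rewrite -preimage_bigcup; exact: mpre.
Qed.

HB.instance Definition _ := isMeasure.Build _ _ _ lebesgue_step
  step0 step_ge0 step_sigma_additive.

Let step_sigma_finite : sigma_finite setT lebesgue_step.
Proof.
have /sigma_finiteP[F [TF ndF Foo]] := sigma_finiteT (@lebesgue_measure R).
have /sigma_finiteP[G [TG ndG Goo]] := sigma_finiteT mu.
pose un (t : tupleR n.+1) : measurableTypeR R * tupleR n :=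
  (tnth t ord0, [tuple of behead t]).
have mun : measurable_fun setT un.
  apply/measurable_fun_pairP; split; first exact: measurable_tnth.
  exact: measurable_behead.
have unK p : un (tuple_cons p) = p.
  by case: p => x t; congr pair; apply/val_inj.
exists (fun k => un @^-1` (F k `*` G k)).
  apply/esym; rewrite -subTset => t _.
  have [k _ Fk] : (\bigcup_k F k) (un t).1 by rewrite -TF.
  have [l _ Gl] : (\bigcup_k G k) (un t).2 by rewrite -TG.
  exists (maxn k l) => //; split.
  - by move: Fk; exact/subsetPset/ndF/leq_maxl.
  - by move: Gl; exact/subsetPset/ndG/leq_maxr.
move=> k; have [mFk Fk] := Foo k; have [mGk Gk] := Goo k; split.
  by rewrite -[X in measurable X]setTI; apply: mun => //; exact: measurableX.
rewrite /lebesgue_step /pushforward (_ : _ @^-1` _ = F k `*` G k).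
  by rewrite product_measure1E// lte_mul_pinfty// ge0_fin_numE.
by rewrite -comp_preimage (_ : un \o _ = id)//; apply/funext => p; exact: unK.
Qed.

HB.instance Definition _ := Measure_isSigmaFinite.Build _ _ _ lebesgue_step
  step_sigma_finite.

End Step.

Fixpoint lebesgue_measure_tuple n :
    {sigma_finite_measure set (tupleR n) -> \bar R} :=
  match n with
  | 0 => @dirac _ (tupleR 0) [tuple] R
  | n'.+1 => lebesgue_step (lebesgue_measure_tuple n')
  end.

Definition row_of_tuple n (t : tupleR n) : 'rV[R]_n := \row_i tnth t i.

End LebesgueMeasure.

(* The norm `|x| of 'rV[R]_n in the library is the sup norm. *)
Definition enorm (R : realType) n (x : 'rV[R]_n) : R :=
  Num.sqrt (\sum_i x 0 i ^+ 2).

(* (n-1)-dimensional measure of the unit sphere of R^n, through polar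
   coordinates: the surface measure of a subset E of the sphere is n times the
   Lebesgue measure of the cone {s u | 0 < s <= 1, u \in E}. *)
Definition unit_sphere_area (R : realType) n : R :=
  n%:R * fine (lebesgue_measure_tuple R n
    [set t | exists s u, [/\ 0 < s <= 1, enorm u = 1
                           & row_of_tuple t = s *: u]]).

Section Differentiability.
Variables (R : realType) (V : normedModType R).

Definition iter_derive (s : seq V) (f : V -> R) : V -> R :=
  foldr (fun v g => 'D_v g) f s.

(* Class C^k on an open set A: the iterated directional derivatives of order
   at most k exist and are continuous on A.  'D_v is a total operator, hence
   the explicit derivability clause. *)
Definition Ck_on (k : nat) (A : set V) (f : V -> R) : Prop :=
  forall s : seq V, (size s <= k)%N -> forall x, A x ->
    {for x, continuous (iter_derive s f)} /\
    ((size s < k)%N -> forall v, derivable (iter_derive s f) x v).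

Definition smooth_on (A : set V) (f : V -> R) : Prop :=
  forall k, Ck_on k A f.

End Differentiability.

Section GreenFunction.
Variables (R : realType) (n : nat).
Local Notation V := 'rV[R]_n.
Implicit Types (A : set V) (u phi : V -> R) (G H : V -> V -> R).

Definition laplacian u (x : V) : R :=
  \sum_(i < n) 'D_(delta_mx 0 i) ('D_(delta_mx 0 i) u) x.

Definition harmonic_on A u : Prop :=
  Ck_on 2 A u /\ forall x, A x -> laplacian u x = 0.

Definition test_function A phi : Prop :=
  smooth_on [set: V] phi /\
  exists K : set V, [/\ compact K, K `<=` A & forall x, ~ K x -> phi x = 0].

Definition locally_integrable A u : Prop :=
  forall K : set V, compact K -> K `<=` A ->
    (lebesgue_measure_tuple R n).-integrable
      (@row_of_tuple R n @^-1` K) (fun t => (u (row_of_tuple t))%:E).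

(* - Laplacian u = delta_y in A, in the sense of distributions *)
Definition minus_laplacian_eq_dirac A u (y : V) : Prop :=
  locally_integrable A u /\
  forall phi, test_function A phi ->
    (\int[lebesgue_measure_tuple R n]_(t in @row_of_tuple R n @^-1` A)
       (u (row_of_tuple t) * - laplacian phi (row_of_tuple t))%:E)%E
    = (phi y)%:E.

(* The Dirichlet condition G(., y) = 0 on the boundary is attained
   continuously: without the third clause it would not relate the boundary
   values to those inside A. *)
Definition is_green_function A G : Prop :=
  forall y, A y ->
    [/\ minus_laplacian_eq_dirac A (G^~ y) y,
        forall x, (closure A `\` interior A) x -> G x y = 0
      & {within closure A `\ y, continuous (G^~ y)}].

Definition fundamental_solution (z : V) : R :=
  if n == 2 then - (2 * pi)^-1 * ln (enorm z)
  else ((n%:R - 2) * unit_sphere_area R n * enorm z ^+ (n - 2))^-1.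

Definition is_regular_part A G H : Prop :=
  [/\ forall x y, A x -> A y -> x <> y ->
        G x y = fundamental_solution (x - y) + H x y,
      smooth_on (A `*` A) (fun p : V * V => H p.1 p.2),
      forall y, A y -> harmonic_on A (H^~ y)
    & forall x, A x -> harmonic_on A (H x)].

Definition robin H (x : V) : R := H x x.

Definition annulus (a : R) : set V := [set x | a < enorm x < 1].

End GreenFunction.

Arguments annulus {R} n a.

(* Main.v *)
Require Import Defs.
From mathcomp Require Import all_boot all_order all_algebra.
From mathcomp Require Import all_classical all_reals all_analysis.
From mathcomp Require Import ring lra.

(** Since [G = 0] on the boundary, [H] equals minus the fundamental solution there; this is why the
    images approximate [-H] (after normalisation) and why the argument is about [-R_A]. For fixed
    [y] the approximation is uniform in [x] over the whole annulus: [H] is harmonic across [x = y],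
    so the estimate can be read on the diagonal although [G] is singular there. The singled out
    images are those whose diagonal distance [|r^2/b - b|] vanishes at an end of the interval: the
    zero is [r = b], and among the powers of [a] only [1] and [a] lie in [[a, 1]]. The limit along
    the diagonal is only pointwise, so monotonicity of the flux [r^(n-1) d/dr] travels as a
    three-point slope inequality; it is turned back into a statement on derivatives at the end,
    where smoothness of [H] makes the limit differentiable. Strict monotonicity of the flux would
    still allow a vanishing derivative at its zero; this is excluded by comparing its increments
    with those of the image [b = 1], which grow at least linearly. *)

(* The Green function of the annulus is the sum over j in Z, b = a^j, of the
   images psi(|x|^2 / b^2 - 2 x.y + b^2 |y|^2) minus their Kelvin transforms
   psi(|x|^2 |y|^2 / b^2 - 2 x.y + b^2), where psi(|z|^2) is the fundamental
   solution: the image of parameter b cancels the Kelvin image of parameter 1/b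
   on |x| = 1 and the one of parameter a/b on |x| = a.  In the plane one must add
   a multiple of log |x| log |y|.  The boundary error of a truncated sum tends to
   zero, so by the maximum principle the truncated sums converge to the regular
   part H; neither their derivatives nor the distributional equation are needed.

   On the diagonal |x| = |y| = r, each term of the resulting expansion of -R_A
   makes r^(n-1) d/dr nondecreasing.  This is convexity with respect to the
   radial harmonic function, hence survives the limit, and it remains true after
   removal of the Kelvin image b = 1 or b = a.  These two images are explicit and
   give strictness and the blow-up of r^(n-1) R_A' at r = 1 and r = a: it
   decreases from +oo to -oo with negative derivative. *)

Set Implicit Arguments.
Unset Strict Implicit.
Unset Printing Implicit Defensive.
Import Order.TTheory GRing.Theory Num.Theory.
Import numFieldNormedType.Exports.

Local Open Scope ring_scope.
Local Open Scope classical_set_scope.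

(** * The fundamental solution *)

Section PointwiseDerivatives.
Variable R : realType.
Implicit Types (f g : R -> R) (x df dg : R).

Lemma is_derive_cstf (c x : R) : is_derive x 1 (fun=> c) 0.
Proof. exact: is_derive_cst. Qed.

Lemma is_derive_idf x : is_derive x 1 (fun t => t) 1.
Proof. exact: is_derive_id. Qed.

Lemma is_derive_addf f g x df dg : is_derive x 1 f df -> is_derive x 1 g dg ->
  is_derive x 1 (fun t => f t + g t) (df + dg).
Proof. exact: is_deriveD. Qed.

Lemma is_derive_oppf f x df : is_derive x 1 f df ->
  is_derive x 1 (fun t => - f t) (- df).
Proof. exact: is_deriveN. Qed.

Lemma is_derive_mulf f g x df dg : is_derive x 1 f df -> is_derive x 1 g dg ->
  is_derive x 1 (fun t => f t * g t) (df * g x + f x * dg).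
Proof.
move=> hf hg; apply: is_derive_eq (is_deriveM hf hg) _.
by rewrite addrC; congr (_ + _); exact: mulrC.
Qed.

Lemma is_derive_expf f n x df : is_derive x 1 f df ->
  is_derive x 1 (fun t => f t ^+ n) (n%:R * f x ^+ n.-1 * df).
Proof.
by move=> /(is_deriveX n); rewrite exprfctE.
Qed.

Lemma is_derive_invf f x df : f x != 0 -> is_derive x 1 f df ->
  is_derive x 1 (fun t => (f t)^-1) (- df / f x ^+ 2).
Proof.
move=> f0 hf; apply: is_derive_eq (is_deriveV f0 hf) _.
by rewrite /GRing.scale/= mulNr mulrC mulNr.
Qed.

Lemma is_derive_compf f g x df dg :
  is_derive (g x) 1 f df -> is_derive x 1 g dg ->
  is_derive x 1 (fun t => f (g t)) (df * dg).
Proof. by move=> hf hg; exact: is_derive1_comp. Qed.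

End PointwiseDerivatives.

Section Potential.
Variables (R : realType) (m : nat).
Implicit Types s t z : R.

Definition powhalf s : R := expR (- (m%:R / 2) * ln s).

(* The radial fundamental solution as a function of s = |z|^2, normalised so
   that potential 1 = 0: then 1 + m * potential = powhalf in every dimension
   m + 2, the planar case included. *)
Definition potential s : R :=
  if m == 0%N then - (ln s / 2) else (powhalf s - 1) / m%:R.

Lemma powhalfM s t : 0 < s -> 0 < t -> powhalf (s * t) = powhalf s * powhalf t.
Proof. by move=> s0 t0; rewrite /powhalf lnM// mulrDr expRD. Qed.

Lemma powhalf_sqr z : z != 0 -> powhalf (z ^+ 2) = (`|z| ^+ m)^-1.
Proof.
move=> z0; rewrite -[z ^+ 2]ger0_norm ?sqr_ge0// normrX /powhalf lnXn ?normr_gt0//.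
rewrite -[ln _ *+ 2]mulr_natl mulrA mulNr divfK ?pnatr_eq0// mulNr expRN expRM_natl lnK//.
by rewrite posrE normr_gt0.
Qed.

Lemma potential1 : potential 1 = 0.
Proof. by rewrite /potential /powhalf ln1 mulr0 expR0 subrr !mul0r oppr0 if_same. Qed.

Lemma is_derive_powhalf s : 0 < s ->
  is_derive s 1 powhalf (- (m%:R / 2) * powhalf s / s).
Proof.
move=> s0; have h := is_derive_mulf (is_derive_cstf (- (m%:R / 2)) s) (is_derive1_ln s0).
apply: is_derive_eq (is_derive_compf (is_derive_expR _) h) _.
by rewrite /= mul0r add0r -/(powhalf s); ring.
Qed.

Lemma is_derive_potential s : 0 < s ->
  is_derive s 1 potential (- (powhalf s / (2 * s))).
Proof.
move=> s0; rewrite /potential; case: (eqVneq m 0%N) => [m0|m0] /=.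
  have h := is_derive_mulf (is_derive1_ln s0) (is_derive_cstf 2^-1 s).
  apply: is_derive_eq (is_derive_oppf h) _.
  rewrite /powhalf m0 mul0r oppr0 mul0r expR0; field.
  by rewrite gt_eqF.
have h := is_derive_addf (is_derive_powhalf s0) (is_derive_cstf (-1) s).
apply: is_derive_eq (is_derive_mulf h (is_derive_cstf m%:R^-1 s)) _.
by field; rewrite gt_eqF//= pnatr_eq0.
Qed.

Lemma potential_decr s t : 0 < s -> s < t -> potential t < potential s.
Proof.
move=> s0 st; have t0 := lt_trans s0 st.
have lst : ln s < ln t by rewrite ltr_ln.
rewrite /potential; case: (eqVneq m 0%N) => [_|m0]; first lra.
have m1 : 0 < m%:R :> R by rewrite ltr0n lt0n.
rewrite ltr_pM2r ?invr_gt0// ltrD2r /powhalf ltr_expR.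
by rewrite !mulNr ltrN2 ltr_pM2l// divr_gt0.
Qed.

End Potential.

(** * Convexity in the radial harmonic variable *)

(** A derivative known at a single point suffices, so that sign arguments never require continuity
    of the derivative. *)
Lemma derive_gt0_near (R : realType) (f : R -> R) (x l : R) :
  is_derive x 1 f l -> 0 < l ->
  exists2 d, 0 < d & forall h, 0 < h < d -> f (x - h) < f x < f (x + h).
Proof.
move=> [df <-] l0; move: (df) => /cvgr_gt -/(_ _ l0).
case=> d /= d0 Hd; exists d => // h /andP[h0 hd].
have [hN0 hn0] : h != 0 /\ - h != 0 by rewrite oppr_eq0 gt_eqF.
have := Hd h; have := Hd (- h); rewrite /= !sub0r opprK normrN gtr0_norm//.
move=> /(_ hd hn0) + /(_ hd hN0); rewrite /GRing.scale/= !mulr1.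
rewrite invrN mulNr oppr_gt0 (addrC _ x) pmulr_rlt0 ?invr_gt0// subr_lt0 => ->.
by rewrite pmulr_rgt0 ?invr_gt0// subr_gt0 addrC.
Qed.

Lemma mean_value (R : realType) (f df : R -> R) (r s : R) : r < s ->
  (forall t, r <= t <= s -> is_derive t 1 f (df t)) ->
  exists2 c, r < c < s & f s - f r = df c * (s - r).
Proof.
move=> rs dfE; have [||c] := @MVT R f df r s rs.
- move=> x; rewrite in_itv/= => /andP[rx xs]; apply: dfE.
  by rewrite !ltW.
- apply: derivable_within_continuous => x; rewrite in_itv/= => /dfE hx.
  exact: ex_derive.
- by rewrite in_itv/= => rcs ->; exists c.
Qed.

Section RadialConvexity.
Variables (R : realType) (m : nat) (a b : R).
Hypothesis a0 : 0 < a.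
Implicit Types (w dw : R -> R) (r s t : R).

Let sigma r : R := potential m (r ^+ 2).

Lemma is_derive_radial_potential r : 0 < r ->
  is_derive r 1 (fun t => potential m (t ^+ 2)) (- (r ^+ m.+1)^-1).
Proof.
move=> r0; have r20 : 0 < r ^+ 2 by rewrite exprn_gt0.
have h := is_derive_expf 2 (is_derive_idf r).
apply: is_derive_eq (is_derive_compf (g := fun t => t ^+ 2) (is_derive_potential m r20) h) _.
rewrite powhalf_sqr ?gt_eqF// gtr0_norm// [r ^+ m.+1]exprS /=.
by field; rewrite expf_neq0 ?gt_eqF.
Qed.

Lemma radial_potential_decr r s : 0 < r -> r < s -> sigma s < sigma r.
Proof.
move=> r0 rs; apply: potential_decr; first by rewrite exprn_gt0.
by rewrite ltr_pXn2r// nnegrE ltW// (lt_trans r0).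
Qed.

(* Convexity of w on ]a, b[ with respect to the variable - sigma: in dimension
   m + 2 this is nonnegativity of the radial Laplacian
   r^-(m+1) (r^(m+1) w')', but it is stable under pointwise limits. *)
Definition radially_convex w := forall r s t, a < r -> r < s -> s < t -> t < b ->
  (sigma s - sigma t) * (w s - w r) <= (sigma r - sigma s) * (w t - w s).

(** With [P] the flux at the middle point [s], the function [w + P sigma] has derivative [<= 0] to
    the left of [s] and [>= 0] to its right. The mean value theorem on each side bounds both slopes
    of [w] by [P]. *)
Lemma radially_convex_flux w dw :
  (forall r, a < r < b -> is_derive r 1 w (dw r)) ->
  (forall r s, a < r -> r < s -> s < b ->
    r ^+ m.+1 * dw r <= s ^+ m.+1 * dw s) ->
  radially_convex w.
Proof.
have a_gt0 := a0; move=> dwE Phi r s t ar rs st tb; set P := s ^+ m.+1 * dw s.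
have s1 : sigma s < sigma r by apply: radial_potential_decr => //; lra.
have s2 : sigma t < sigma s by apply: radial_potential_decr => //; lra.
have dz u : a < u < b ->
    is_derive u 1 (fun v => w v + P * sigma v) (dw u - P * (u ^+ m.+1)^-1).
  move=> aub; have u0 : 0 < u by case/andP: aub => au _; exact: lt_trans au.
  have h := is_derive_mulf (is_derive_cstf P u) (is_derive_radial_potential u0).
  by apply: is_derive_eq (is_derive_addf (dwE u aub) h) _; ring.
have dzE u : a < u -> u ^+ m.+1 * dw u <= P -> dw u - P * (u ^+ m.+1)^-1 <= 0.
  move=> au; have u0 : 0 < u ^+ m.+1 by rewrite exprn_gt0 ?(lt_trans a0).
  by rewrite subr_le0 ler_pdivlMr// mulrC.
have dzE' u : a < u -> P <= u ^+ m.+1 * dw u -> 0 <= dw u - P * (u ^+ m.+1)^-1.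
  move=> au; have u0 : 0 < u ^+ m.+1 by rewrite exprn_gt0 ?(lt_trans a0).
  by rewrite subr_ge0 ler_pdivrMr// mulrC.
have [u /andP[u1 u2] E1] : exists2 c, r < c < s & (w s + P * sigma s)
    - (w r + P * sigma r) = (dw c - P * (c ^+ m.+1)^-1) * (s - r).
  apply: (@mean_value _ (fun v => w v + P * sigma v)) => // u /andP[u1 u2].
  by apply: dz; lra.
have [v /andP[v1 v2] E2] : exists2 c, s < c < t & (w t + P * sigma t)
    - (w s + P * sigma s) = (dw c - P * (c ^+ m.+1)^-1) * (t - s).
  apply: (@mean_value _ (fun v => w v + P * sigma v)) => // v /andP[v1 v2].
  by apply: dz; lra.
have H1 : (dw u - P * (u ^+ m.+1)^-1) * (s - r) <= 0.
  apply: mulr_le0_ge0; last lra.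
  apply: dzE; first lra.
  by apply: Phi; lra.
have H2 : 0 <= (dw v - P * (v ^+ m.+1)^-1) * (t - s).
  apply: mulr_ge0; last lra.
  apply: dzE'; first lra.
  by apply: Phi; lra.
have K1 : w s - w r <= P * (sigma r - sigma s) by lra.
have K2 : P * (sigma s - sigma t) <= w t - w s by lra.
apply: (@le_trans _ _ ((sigma s - sigma t) * (P * (sigma r - sigma s)))).
  by rewrite ler_pM2l//; lra.
rewrite (_ : _ * (P * _) = (sigma r - sigma s) * (P * (sigma s - sigma t))); last by ring.
by rewrite ler_pM2l//; lra.
Qed.

(** If the flux dropped from [r] to [s], take [P] halfway between its two values. Then
    [w + P sigma], still convex in [- sigma], would increase at [r] and decrease at [s], which
    convexity forbids. *)
Lemma flux_radially_convex w dw :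
  (forall r, a < r < b -> is_derive r 1 w (dw r)) -> radially_convex w ->
  forall r s, a < r -> r < s -> s < b ->
    r ^+ m.+1 * dw r <= s ^+ m.+1 * dw s.
Proof.
have a_gt0 := a0; move=> dwE cw r s ar rs sb; rewrite leNgt; apply/negP => lt_Phi.
set P := (r ^+ m.+1 * dw r + s ^+ m.+1 * dw s) / 2.
have [P1 P2] : P < r ^+ m.+1 * dw r /\ s ^+ m.+1 * dw s < P by rewrite /P; split; lra.
pose z v := w v + P * sigma v.
(* Adding a multiple of [sigma] preserves the slope inequality; hence once [z] has increased it
   keeps increasing. *)
have convz x y t : a < x -> x < y -> y < t -> t < b -> z x < z y -> z y < z t.
  clear -cw a_gt0; move=> ax xy yt tb zxy; have := cw x y t ax xy yt tb.
  have s1 : sigma y < sigma x by apply: radial_potential_decr => //; lra.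
  have s2 : sigma t < sigma y by apply: radial_potential_decr => //; lra.
  have E1 : w y - w x = z y - z x - P * (sigma y - sigma x) by rewrite /z; ring.
  have E2 : w t - w y = z t - z y - P * (sigma t - sigma y) by rewrite /z; ring.
  rewrite {}E1 {}E2 => H; rewrite -subr_gt0.
  have K : 0 < (sigma y - sigma t) * (z y - z x) by apply: mulr_gt0; lra.
  rewrite -(pmulr_rgt0 _ (_ : 0 < sigma x - sigma y)); last lra.
  by apply: (lt_le_trans K); move: H; rewrite !mulrBr; lra.
have dz u : a < u < b -> is_derive u 1 z (dw u - P * (u ^+ m.+1)^-1).
  move=> aub; have u0 : 0 < u by case/andP: aub => au _; exact: lt_trans au.
  have h := is_derive_mulf (is_derive_cstf P u) (is_derive_radial_potential u0).
  by apply: is_derive_eq (is_derive_addf (dwE u aub) h) _; ring.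
have zr : 0 < dw r - P * (r ^+ m.+1)^-1.
  by rewrite subr_gt0 ltr_pdivrMr 1?mulrC// exprn_gt0// (lt_trans a0).
have zs : 0 < - (dw s - P * (s ^+ m.+1)^-1).
  by rewrite oppr_gt0 subr_lt0 ltr_pdivlMr 1?mulrC// exprn_gt0//; lra.
have [//|d d0 Hd] := derive_gt0_near (dz r _) zr; first lra.
have [//|e e0 He] := derive_gt0_near (is_derive_oppf (dz s _)) zs; first lra.
(* A third, so that [r + h < s - h] and the points [r], [r + h], [s - h], [s] are in order. *)
pose h := Num.min (Num.min d e) (s - r) / 3.
have h0 : 0 < h by rewrite divr_gt0// !lt_min d0 e0/=; lra.
have hmin : 3 * h = Num.min (Num.min d e) (s - r) by rewrite /h; field.
have : 3 * h <= Num.min (Num.min d e) (s - r) by rewrite hmin.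
rewrite !le_min => /andP[/andP[hd he] hrs].
have /Hd/andP[_ z1] : 0 < h < d by lra.
have /He/andP[z2 _] : 0 < h < e by lra.
rewrite ltrN2 in z2.
clear zr zs Hd He P1 P2 lt_Phi dz dwE cw d0 e0.
have c1 : z (r + h) < z (s - h) by apply: (convz r) => //; lra.
have : z (s - h) < z s by apply: (convz r) => //; lra.
lra.
Qed.

Lemma radially_convexD w1 w2 : radially_convex w1 -> radially_convex w2 ->
  radially_convex (fun r => w1 r + w2 r).
Proof.
move=> c1 c2 r s t ar rs st tb.
by have := lerD (c1 r s t ar rs st tb) (c2 r s t ar rs st tb); rewrite -!mulrDr; lra.
Qed.

Lemma radially_convex_eq w1 w2 : (forall r, a < r < b -> w1 r = w2 r) ->
  radially_convex w1 -> radially_convex w2.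
Proof.
move=> E c1 r s t ar rs st tb; have := c1 r s t ar rs st tb.
by rewrite !E//; lra.
Qed.

Lemma radially_convex_cst c : radially_convex (fun=> c).
Proof. by move=> r s t *; rewrite !subrr !mulr0. Qed.

Lemma radially_convex_sum (I : Type) (l : seq I) (P : pred I) (F : I -> R -> R) :
  (forall i, P i -> radially_convex (F i)) ->
  radially_convex (fun r => \sum_(i <- l | P i) F i r).
Proof.
move=> cF; elim: l => [|i l IH].
  apply: (@radially_convex_eq (fun=> 0)); last exact: radially_convex_cst.
  by move=> r _; rewrite big_nil.
case Pi : (P i).
- apply: (@radially_convex_eq (fun r => F i r + \sum_(i <- l | P i) F i r)).
    by move=> r _; rewrite big_cons Pi.
  by apply: radially_convexD; [exact: cF|].
- by apply: radially_convex_eq IH => r _; rewrite big_cons Pi.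
Qed.

Lemma radially_convex_lim w (v : nat -> R -> R) :
  (forall N, (0 < N)%N -> radially_convex (v N)) ->
  (forall r e, a < r < b -> 0 < e ->
    exists N0, forall N, (N0 <= N)%N -> `|w r - v N r| <= e) ->
  radially_convex w.
Proof.
have a_gt0 := a0; move=> cv appr r s t ar rs st tb; rewrite leNgt; apply/negP => lt_w.
have s1 : sigma s < sigma r by apply: radial_potential_decr => //; lra.
have s2 : sigma t < sigma s by apply: radial_potential_decr => //; lra.
set A := sigma s - sigma t; set B := sigma r - sigma s.
have A0 : 0 < A by rewrite /A; lra.
have B0 : 0 < B by rewrite /B; lra.
rewrite -/A -/B -subr_gt0 in lt_w; set D := (X in 0 < X) in lt_w.
(* [D] is the defect in the inequality; errors [e] at the three points change it by at most
   [2 e (A + B) = D / 2]. *)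
pose e := D / (4 * (A + B)).
have e0 : 0 < e by rewrite divr_gt0// mulr_gt0//; lra.
have [|N1 H1] := appr r e _ e0; first lra.
have [|N2 H2] := appr s e _ e0; first lra.
have [|N3 H3] := appr t e _ e0; first lra.
pose N := (N1 + N2 + N3).+1.
have [i1 i2 i3] : [/\ (N1 <= N)%N, (N2 <= N)%N & (N3 <= N)%N].
  by split; rewrite leqW// ?leq_addl// -?addnA ?leq_addr// addnCA leq_addr.
have := cv N isT r s t ar rs st tb; rewrite -/A -/B => H.
move: (H1 N i1) (H2 N i2) (H3 N i3); rewrite !ler_norml.
move=> /andP[t1 t2] /andP[r1 r2] /andP[u1 u2].
have K1 : A * (w s - w r) <= A * (v N s - v N r + 2 * e) by rewrite ler_pM2l//; lra.
have K2 : B * (v N t - v N s - 2 * e) <= B * (w t - w s) by rewrite ler_pM2l//; lra.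
have : D <= 2 * e * (A + B) by rewrite /D; lra.
have -> : 2 * e * (A + B) = D / 2 by rewrite /e; field; rewrite gt_eqF//; lra.
lra.
Qed.

End RadialConvexity.

(** * Flux of the image terms on the diagonal *)

Section ImageTerms.
Variables (R : realType) (m : nat) (a : R).
Hypothesis a01 : 0 < a < 1.
Implicit Types q r s : R.

(* The image terms restricted to the diagonal x = y, |x| = r. *)
Definition kelvin_diag q r : R := potential m ((r ^+ 2 / q - q) ^+ 2).
Definition scaled_diag q r : R := potential m (r ^+ 2 * (q^-1 - q) ^+ 2).

Definition kelvin_diag' q r : R :=
  - (2 * r / q) / ((r ^+ 2 / q - q) * `|r ^+ 2 / q - q| ^+ m).

Lemma is_derive_kelvin_diag q r : 0 < q -> r ^+ 2 / q - q != 0 ->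
  is_derive r 1 (kelvin_diag q) (kelvin_diag' q r).
Proof.
move=> q0 z0; have z20 : 0 < (r ^+ 2 / q - q) ^+ 2 by rewrite exprn_even_gt0.
have h1 := is_derive_mulf (is_derive_expf 2 (is_derive_idf r)) (is_derive_cstf q^-1 r).
have h := is_derive_expf 2 (is_derive_addf h1 (is_derive_cstf (- q) r)).
apply: is_derive_eq
  (is_derive_compf (g := fun t => (t ^+ 2 / q - q) ^+ 2) (is_derive_potential m z20) h) _.
rewrite powhalf_sqr// /kelvin_diag' /=; set y := `|_| ^+ m.
have y0 : y != 0 by rewrite expf_neq0// normr_eq0.
move: z0 y0; move: y; set z := r ^+ 2 / q - q => y z0 y0.
by field; rewrite z0 y0 gt_eqF.
Qed.

Lemma is_derive_scaled_diag q r : 0 < q -> q != 1 -> 0 < r ->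
  is_derive r 1 (scaled_diag q)
    (- (r ^+ m.+1)^-1 * (`|q^-1 - q| ^+ m)^-1).
Proof.
move=> q0 q1 r0; have c0 : q^-1 - q != 0.
  apply: contra q1 => /eqP E; have : (q - 1) * (q + 1) = 0.
    have : q * (q^-1 - q) = 0 by rewrite E mulr0.
    by rewrite mulrBr mulfV ?gt_eqF//; lra.
  by move/eqP; rewrite mulf_eq0 subr_eq0 orbC gt_eqF//; lra.
have s0 : 0 < r ^+ 2 * (q^-1 - q) ^+ 2 by rewrite mulr_gt0 ?exprn_even_gt0//= gt_eqF.
have h := is_derive_mulf (is_derive_expf 2 (is_derive_idf r))
  (is_derive_cstf ((q^-1 - q) ^+ 2) r).
apply: is_derive_eq (is_derive_compf
  (g := fun t => t ^+ 2 * (q^-1 - q) ^+ 2) (is_derive_potential m s0) h) _.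
rewrite (_ : powhalf m _ = (r ^+ m * `|q^-1 - q| ^+ m)^-1); last first.
  have rc0 : r * (q^-1 - q) != 0 by rewrite mulf_neq0// gt_eqF.
  by rewrite -exprMn powhalf_sqr// normrM (gtr0_norm r0) exprMn.
rewrite [r ^+ m.+1]exprS /=; set y := `|_| ^+ m; set x := r ^+ m.
have y0 : y != 0 by rewrite expf_neq0// normr_eq0.
have x0 : x != 0 by rewrite expf_neq0// gt_eqF.
move: c0 x0 y0; move: x y; set z := q^-1 - q => x y z0 x0 y0.
by field; rewrite z0 x0 y0 gt_eqF.
Qed.

Lemma kelvin_diag_arg_lt0 q r : 1 <= q -> a < r < 1 -> r ^+ 2 / q - q < 0.
Proof.
move=> q1 /andP[ar r1]; have a0 : 0 < a by case/andP: a01.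
have q0 : 0 < q by lra.
rewrite subr_lt0 ltr_pdivrMr// -expr2 ltr_pXn2r// ?nnegrE; lra.
Qed.

Lemma kelvin_diag_arg_gt0 q r : 0 < q <= a -> a < r < 1 -> 0 < r ^+ 2 / q - q.
Proof.
move=> /andP[q0 qa] /andP[ar r1]; have a0 : 0 < a by case/andP: a01.
rewrite subr_gt0 ltr_pdivlMr// -expr2 ltr_pXn2r// ?nnegrE; lra.
Qed.

(** In this form each factor is positive and strictly increasing in [r]: the numerators grow and
    [q - r^2/q] decreases. *)
Lemma kelvin_diag_flux_outer q r : 1 <= q -> a < r < 1 ->
  r ^+ m.+1 * kelvin_diag' q r = 2 / q * (r * (r / (q - r ^+ 2 / q)) ^+ m.+1).
Proof.
move=> q1 r1; have z0 := kelvin_diag_arg_lt0 q1 r1.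
rewrite /kelvin_diag' ltr0_norm// opprB.
set z := q - r ^+ 2 / q; have zE : r ^+ 2 / q - q = - z by rewrite opprB.
have {}z0 : 0 < z by rewrite -oppr_lt0 -zE.
rewrite zE expr_div_n [z ^+ m.+1]exprS; set y := z ^+ m.
have y0 : y != 0 by rewrite expf_neq0// gt_eqF.
by field; rewrite y0 (gt_eqF z0) gt_eqF//; lra.
Qed.

(** The power [r^(m+2)] is split as [r^2] and [r^m] so that both quotients decrease in [r]; grouping
    as in the outer case would leave an increasing factor [r]. *)
Lemma kelvin_diag_flux_inner q r : 0 < q <= a -> a < r < 1 ->
  r ^+ m.+1 * kelvin_diag' q r =
    - (2 / q * (r ^+ 2 / (r ^+ 2 / q - q) * (r / (r ^+ 2 / q - q)) ^+ m)).
Proof.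
move=> q0a r1; have z0 := kelvin_diag_arg_gt0 q0a r1.
rewrite /kelvin_diag' gtr0_norm// expr_div_n.
set z := r ^+ 2 / q - q in z0 *; set y := z ^+ m.
have y0 : y != 0 by rewrite expf_neq0// gt_eqF.
rewrite exprS; field; rewrite y0 (gt_eqF z0) gt_eqF//.
by case/andP: q0a.
Qed.

Lemma kelvin_diag_flux_outer_incr q r s : 1 <= q -> a < r -> r < s -> s < 1 ->
  r ^+ m.+1 * kelvin_diag' q r < s ^+ m.+1 * kelvin_diag' q s.
Proof.
move=> q1 ar rs s1; have a0 : 0 < a by case/andP: a01.
have r1 : a < r < 1 by lra. have s2 : a < s < 1 by lra.
have r0 : 0 < r by lra. have q0 : 0 < q by lra.
rewrite !kelvin_diag_flux_outer// ltr_pM2l; last by rewrite divr_gt0.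
have zr := kelvin_diag_arg_lt0 q1 r1; have zs := kelvin_diag_arg_lt0 q1 s2.
have rs2 : r ^+ 2 / q < s ^+ 2 / q.
  by rewrite ltr_pM2r ?invr_gt0// ltr_pXn2r// nnegrE; lra.
have [h1 h2] : 0 < q - r ^+ 2 / q /\ 0 < q - s ^+ 2 / q by lra.
apply: ltr_pM => //; first lra.
  by rewrite exprn_ge0// divr_ge0; lra.
rewrite ltr_pXn2r ?nnegrE ?divr_ge0//; [|lra..].
by rewrite ltr_pM ?invr_ge0//; [lra|lra|rewrite ltf_pV2//; lra].
Qed.

Lemma kelvin_diag_flux_inner_incr q r s : 0 < q <= a -> a < r -> r < s -> s < 1 ->
  r ^+ m.+1 * kelvin_diag' q r <= s ^+ m.+1 * kelvin_diag' q s.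
Proof.
move=> q0a ar rs s1; have a0 : 0 < a by case/andP: a01.
have q0 : 0 < q by case/andP: q0a.
have r1 : a < r < 1 by lra. have s2 : a < s < 1 by lra.
have r0 : 0 < r by lra. have s0 : 0 < s by lra.
rewrite !kelvin_diag_flux_inner// lerN2 ler_pM2l; last by rewrite divr_gt0.
have zr := kelvin_diag_arg_gt0 q0a r1; have zs := kelvin_diag_arg_gt0 q0a s2.
apply: ler_pM; rewrite ?exprn_ge0 ?divr_ge0 ?exprn_ge0//; try lra.
  rewrite ler_pdivrMr// mulrAC ler_pdivlMr//.
  have -> : s ^+ 2 * (r ^+ 2 / q - q) = s ^+ 2 * r ^+ 2 / q - s ^+ 2 * q by ring.
  have -> : r ^+ 2 * (s ^+ 2 / q - q) = s ^+ 2 * r ^+ 2 / q - r ^+ 2 * q by ring.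
  by rewrite lerD2l lerN2 ler_pM2r// ler_pXn2r// ?nnegrE; lra.
rewrite lerXn2r ?nnegrE ?divr_ge0//; try lra.
rewrite ler_pdivrMr// mulrAC ler_pdivlMr//.
have -> : s * (r ^+ 2 / q - q) = s * r * (r / q) - s * q by ring.
have -> : r * (s ^+ 2 / q - q) = s * r * (s / q) - r * q by ring.
have : s * r * (r / q) <= s * r * (s / q).
  by rewrite ler_pM2l ?mulr_gt0// ler_pM2r ?invr_gt0//; lra.
have : r * q <= s * q by rewrite ler_pM2r//; lra.
lra.
Qed.

Lemma kelvin_diag_neq0 q r : 0 < q <= a \/ 1 <= q -> a < r < 1 ->
  r ^+ 2 / q - q != 0.
Proof.
case=> hq hr; first by rewrite gt_eqF// kelvin_diag_arg_gt0.
by rewrite lt_eqF// kelvin_diag_arg_lt0.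
Qed.

Lemma is_derive_kelvin_diag_image q r : 0 < q <= a \/ 1 <= q -> a < r < 1 ->
  is_derive r 1 (kelvin_diag q) (kelvin_diag' q r).
Proof.
move=> hq hr; apply: is_derive_kelvin_diag; last exact: kelvin_diag_neq0.
by case: hq => [/andP[]|] //; lra.
Qed.

Lemma radially_convex_kelvin_diag q : 0 < q <= a \/ 1 <= q ->
  radially_convex m a 1 (kelvin_diag q).
Proof.
move=> hq; have /andP[a0 _] := a01.
apply: (radially_convex_flux a0 (dw := kelvin_diag' q)).
  by move=> r hr; exact: is_derive_kelvin_diag_image.
move=> r s ar rs s1; case: hq => hq; first exact: kelvin_diag_flux_inner_incr.
by rewrite ltW// kelvin_diag_flux_outer_incr.
Qed.

(** Up to an additive constant, [scaled_diag q] is a multiple of the radial harmonic function, so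
    its flux is constant. *)
Lemma radially_convex_opp_scaled_diag q : 0 < q -> q != 1 ->
  radially_convex m a 1 (fun r => - scaled_diag q r).
Proof.
move=> q0 q1; have /andP[a0 _] := a01.
apply: (radially_convex_flux a0
    (dw := fun r => - (- (r ^+ m.+1)^-1 * (`|q^-1 - q| ^+ m)^-1))).
  move=> r /andP[ar _]; apply: is_derive_oppf.
  by apply: is_derive_scaled_diag => //; exact: lt_trans ar.
move=> r s ar rs s1.
have [r0 s0] : 0 < r /\ 0 < s by lra.
by rewrite !mulNr !opprK !mulrA !mulfV ?mul1r// expf_neq0// gt_eqF.
Qed.

(** The flux is [-2 c potential m (r^2)], and the radial potential decreases. This handles the
    planar correction on the diagonal. *)
Lemma radially_convex_sqr c : 0 <= c ->
  radially_convex m a 1 (fun r => c * potential m (r ^+ 2) ^+ 2).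
Proof.
move=> c0; have /andP[a0 _] := a01.
apply: (radially_convex_flux a0
    (dw := fun r => - (2 * c * potential m (r ^+ 2)) / r ^+ m.+1)).
  move=> r /andP[ar _]; have r0 := lt_trans a0 ar.
  have h := is_derive_expf 2 (is_derive_radial_potential m r0).
  by apply: is_derive_eq (is_derive_mulf (is_derive_cstf c r) h) _; rewrite /=; ring.
move=> r s ar rs s1.
have [r0 s0] : 0 < r /\ 0 < s by lra.
rewrite !mulrA ![_ ^+ m.+1 * _]mulrC !mulfK ?expf_neq0 ?gt_eqF//.
rewrite lerN2 ler_wpM2l//; first by rewrite mulr_ge0.
by rewrite ltW// radial_potential_decr.
Qed.

End ImageTerms.

(** * From flux growth to a unique nondegenerate critical point *)

Section CriticalPoint.
Variables (R : realType) (m : nat) (a : R).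
Hypothesis a01 : 0 < a < 1.
Variables f df ddf : R -> R.
Hypothesis dfE : forall r : R, a < r < 1 -> is_derive r 1 f (df r).
Hypothesis ddfE : forall r : R, a < r < 1 -> is_derive r 1 df (ddf r).
Hypothesis convex_outer :
  radially_convex m a 1 (fun r => f r - kelvin_diag m 1 r).
Hypothesis convex_inner :
  radially_convex m a 1 (fun r => f r - kelvin_diag m a r).

Let flux (r : R) : R := r ^+ m.+1 * df r.

(** The flux of [f] minus the image is nondecreasing, so the flux of [f] grows at least as much as
    the explicit one. Strictness, both unbounded ends and the sign of [ddf] all come from this
    bound. *)
Lemma flux_gap q r s : 0 < q <= a \/ 1 <= q ->
  radially_convex m a 1 (fun r => f r - kelvin_diag m q r) ->
  a < r -> r < s -> s < 1 ->
  s ^+ m.+1 * kelvin_diag' m q s - r ^+ m.+1 * kelvin_diag' m q r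
    <= flux s - flux r.
Proof.
move=> hq cq ar rs s1; have /andP[a0 _] := a01.
have := flux_radially_convex a0 (dw := fun r => df r - kelvin_diag' m q r) _ cq ar rs s1.
rewrite !mulrBr -/(flux r) -/(flux s) => H.
suff : flux r - r ^+ m.+1 * kelvin_diag' m q r <= flux s - s ^+ m.+1 * kelvin_diag' m q s by lra.
apply: H => t ht.
exact: is_derive_addf (dfE ht) (is_derive_oppf (is_derive_kelvin_diag_image m a01 hq ht)).
Qed.

Let flux_incr r s : a < r -> r < s -> s < 1 -> flux r < flux s.
Proof.
move=> ar rs s1; rewrite -subr_gt0.
apply: lt_le_trans (flux_gap (q := 1) _ convex_outer ar rs s1); last by right.
by rewrite subr_gt0 (kelvin_diag_flux_outer_incr _ a01).
Qed.

Let flux_gt0 : exists2 r, (a + 1) / 2 < r < 1 & 0 < flux r.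
Proof.
have /andP[a0 a1] := a01; set c := (a + 1) / 2.
have [ac c1] : a < c /\ c < 1 by rewrite /c; lra.
pose K := `|flux c - c ^+ m.+1 * kelvin_diag' m 1 c| + 1.
have K0 : 0 < K by rewrite /K ltr_wpDl.
pose d := Num.min (Num.min ((1 - c) / 2) (c / 2)) (c ^+ 2 / K).
have c0 : 0 < c by lra.
have d0 : 0 < d.
  by rewrite !lt_min !divr_gt0 ?exprn_gt0//; lra.
have : d <= d by []. rewrite {2}/d !le_min => /andP[/andP[d1 d2] d3].
have cr : c < 1 - d by lra.
have r1 : 1 - d < 1 by lra.
have ar1 : a < 1 - d < 1 by lra.
exists (1 - d); first by rewrite cr r1.
have := flux_gap (q := 1) (or_intror (lexx _)) convex_outer ac cr r1.
rewrite (kelvin_diag_flux_outer m a01 (lexx 1) ar1); set r := 1 - d in cr r1 * => gap.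
have rE : r = 1 - d by [].
have U1 : c / (2 * d) <= r / (1 - r ^+ 2 / 1).
  have -> : r / (1 - r ^+ 2 / 1) = r / (d * (1 + r)).
    by congr (_ / _); rewrite /r; field.
  have h1 : 0 < d * (1 + r) by rewrite mulr_gt0//; lra.
  have h2 : d * (1 + r) <= 2 * d by rewrite mulrC ler_pM2r//; lra.
  by apply: ler_pM; rewrite ?invr_ge0 ?lef_pV2 ?posrE//; lra.
have U2 : 1 <= r / (1 - r ^+ 2 / 1).
  by apply: le_trans U1; rewrite ler_pdivlMr ?mulr_gt0//; lra.
have U3 : r / (1 - r ^+ 2 / 1) <= (r / (1 - r ^+ 2 / 1)) ^+ m.+1.
  by rewrite [leRHS]exprS ler_peMr ?exprn_ege1//; lra.
have U4 : K <= 2 / 1 * (r * (r / (1 - r ^+ 2 / 1)) ^+ m.+1).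
  apply: (@le_trans _ _ (2 / 1 * (c * (c / (2 * d))))); last first.
    rewrite ler_pM2l; last by lra.
    have h1 : 0 <= c / (2 * d) by rewrite divr_ge0//; lra.
    by apply: ler_pM; lra.
  have -> : 2 / 1 * (c * (c / (2 * d))) = c ^+ 2 / d by field; rewrite gt_eqF.
  by rewrite ler_pdivlMr// mulrC -ler_pdivlMr.
have : - K < flux c - c ^+ m.+1 * kelvin_diag' m 1 c.
  rewrite /K; set x := flux c - _.
  by have := ler_norm (- x); rewrite normrN; lra.
lra.
Qed.

Let flux_lt0 : exists2 r, a < r < (a + 1) / 2 & flux r < 0.
Proof.
have /andP[a0 a1] := a01; set c := (a + 1) / 2.
have [ac c1] : a < c /\ c < 1 by rewrite /c; lra.
pose K := `|flux c - c ^+ m.+1 * kelvin_diag' m a c| + 1.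
have K0 : 0 < K by rewrite /K ltr_wpDl.
(* The mirror choice at the inner end: at [r = a + d] the quotient [r / (r^2/a - a)] is at least
   [a / (2 d) >= 1], and the image flux is at most [- a / d <= - K]. *)
pose d := Num.min (Num.min ((c - a) / 2) (a / 2)) (a / K).
have d0 : 0 < d.
  by rewrite !lt_min !divr_gt0//; lra.
have : d <= d by []. rewrite {2}/d !le_min => /andP[/andP[d1 d2] d3].
have rc : a + d < c by lra.
have ar : a < a + d by lra.
have ar1 : a < a + d < 1 by lra.
have a0a : 0 < a <= a by rewrite a0 lexx.
exists (a + d); first by rewrite ar rc.
have := flux_gap (q := a) (or_introl a0a) convex_inner ar rc c1.
rewrite (kelvin_diag_flux_inner m a01 a0a ar1).
have z0 := kelvin_diag_arg_gt0 a01 a0a ar1.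
set r := a + d in z0 rc ar * => gap.
have rE : r = a + d by [].
have U1 : a / (2 * d) <= r / (r ^+ 2 / a - a).
  have -> : r / (r ^+ 2 / a - a) = a / (2 * d) + a / (2 * (r + a)).
    have ra0 : 0 < r + a by lra.
    have E : r ^+ 2 / a - a = d * (r + a) / a by rewrite rE; field; rewrite gt_eqF.
    rewrite E (_ : a / (2 * d) + _ = (r + a + d) * a / (2 * d * (r + a))); last first.
      by field; rewrite !gt_eqF.
    rewrite (_ : r + a + d = 2 * r); last by lra.
    by field; rewrite !gt_eqF.
  have h1 : 0 <= 2 * (r + a) by lra.
  by rewrite lerDl divr_ge0// ltW.
have U2 : 1 <= r / (r ^+ 2 / a - a).
  by apply: le_trans U1; rewrite ler_pdivlMr ?mulr_gt0//; lra.
have U4 : K <= 2 / a * (r ^+ 2 / (r ^+ 2 / a - a) * (r / (r ^+ 2 / a - a)) ^+ m).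
  apply: (@le_trans _ _ (2 / a * (a * (a / (2 * d)) * 1))); last first.
    rewrite ler_pM2l; last by rewrite divr_gt0.
    have h1 : 0 <= a / (2 * d) by rewrite divr_ge0//; lra.
    have h2 : 0 <= a * (a / (2 * d)) by rewrite mulr_ge0//; lra.
    apply: ler_pM => //; last by rewrite exprn_ege1.
    by rewrite expr2 -mulrA; apply: ler_pM => //; lra.
  have -> : 2 / a * (a * (a / (2 * d)) * 1) = a / d by field; rewrite !gt_eqF.
  by rewrite ler_pdivlMr// mulrC -ler_pdivlMr.
have : flux c - c ^+ m.+1 * kelvin_diag' m a c < K.
  rewrite /K; set x := flux c - _.
  by have := ler_norm x; lra.
lra.
Qed.

Lemma radial_critical_point : exists r0,
  [/\ a < r0 < 1, df r0 = 0, forall r, a < r < 1 -> df r = 0 -> r = r0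
    & 0 < ddf r0].
Proof.
have /andP[a0 a1] := a01.
have dflux r : a < r < 1 -> is_derive r 1 flux
    (m.+1%:R * r ^+ m * df r + r ^+ m.+1 * ddf r).
  move=> hr; apply: is_derive_eq
    (is_derive_mulf (is_derive_expf m.+1 (is_derive_idf r)) (ddfE hr)) _.
  by rewrite mulr1.
have [s /andP[as_ sc] fs] := flux_lt0; have [t /andP[ct t1] ft] := flux_gt0.
have [r0 r0st fr0] : exists2 r, r \in `[s, t]%R & flux r = 0.
  apply: IVT; first lra.
    apply: derivable_within_continuous => x; rewrite in_itv/= => hx.
    by apply: ex_derive; apply: dflux; lra.
  by rewrite minElt maxElt; case: ifPn => h; lra.
move: r0st; rewrite in_itv/= => r0st.
have hr0 : a < r0 < 1 by lra.
have p0 (r : R) : a < r < 1 -> 0 < r ^+ m.+1 by move=> hr; rewrite exprn_gt0//; lra.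
have df0 r : a < r < 1 -> df r = 0 -> flux r = 0 by rewrite /flux => _ ->; rewrite mulr0.
have df0r : df r0 = 0.
  by apply/eqP; move/eqP: fr0; rewrite /flux mulf_eq0 gt_eqF ?p0.
exists r0; split => //.
  move=> r hr /(df0 _ hr) fr; case: (ltgtP r r0) => // h.
    suff : flux r < flux r0 by rewrite fr fr0 ltxx.
    by apply: flux_incr => //; lra.
  suff : flux r0 < flux r by rewrite fr fr0 ltxx.
  by apply: flux_incr => //; lra.
rewrite ltNge; apply/negP => ddf0.
(* The image [b = 1] has flux [2 r U(r)], with [U] increasing. If [ddf r0 <= 0], then
   [U(r0) r - flux r] increases at [r0], so the flux gains less than [d U(r0)] over a short step
   [d]; [flux_gap] forces a gain of at least [2 d U(r0)]. *)
pose U (r : R) : R := (r / (1 - r ^+ 2 / 1)) ^+ m.+1.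
have Ur0 : 0 < U r0.
  have := kelvin_diag_arg_lt0 a01 (lexx 1) hr0.
  by move=> h; rewrite /U exprn_gt0// divr_gt0//; lra.
have h := is_derive_addf (is_derive_mulf (is_derive_cstf (U r0) r0) (is_derive_idf r0))
  (is_derive_oppf (dflux _ hr0)).
have [|e e0 He] := derive_gt0_near h.
  rewrite df0r mulr0 !add0r mul0r add0r mulr1.
  by have := mulr_ge0_le0 (ltW (p0 _ hr0)) ddf0; lra.
pose d := Num.min e (1 - r0) / 2.
have d0 : 0 < d by rewrite divr_gt0// lt_min e0; lra.
have : 2 * d <= Num.min e (1 - r0) by rewrite /d; lra.
rewrite le_min => /andP[d1 d2].
have /He/andP[_ H] : 0 < d < e by lra.
have [ar0 r01] := andP hr0.
have rd : r0 < r0 + d by lra.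
have rd1 : r0 + d < 1 by lra.
have ard : a < r0 + d < 1 by lra.
have := flux_gap (q := 1) (or_intror (lexx _)) convex_outer ar0 rd rd1.
rewrite !(kelvin_diag_flux_outer m a01 (lexx 1))// -!/(U _) => gap.
have UU : U r0 <= U (r0 + d).
  have h1 := kelvin_diag_arg_lt0 a01 (lexx 1) hr0.
  have h2 := kelvin_diag_arg_lt0 a01 (lexx 1) ard.
  have h3 : r0 ^+ 2 <= (r0 + d) ^+ 2 by rewrite ler_pXn2r ?nnegrE//; lra.
  rewrite /U lerXn2r// ?nnegrE ?divr_ge0//; [lra..|].
  by rewrite ler_pM ?invr_ge0// ?lef_pV2 ?posrE; lra.
have : (r0 + d) * U r0 <= (r0 + d) * U (r0 + d) by rewrite ler_pM2l//; lra.
have := mulr_gt0 d0 Ur0.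
lra.
Qed.

End CriticalPoint.

(** * Laplacians and the maximum principle *)

Lemma is_derive_line (R : realType) (V : normedModType R) (u : V -> R) (x e : V)
  (t l : R) : is_derive (t *: e + x) e u l ->
  is_derive t 1 (fun s => u (s *: e + x)) l.
Proof.
have E : (fun h : R => h^-1 *: (((fun s => u (s *: e + x)) \o shift t) (h *: 1)
      - u (t *: e + x)))
    = (fun h : R => h^-1 *: ((u \o shift (t *: e + x)) (h *: e) - u (t *: e + x))).
  by apply/funext => h /=; rewrite [h *: 1]mulr1 scalerDl addrA.
by move=> [d <-]; split; [rewrite /derivable E|rewrite /derive E].
Qed.

Section LineLaplacian.
Variables (R : realType) (n : nat).
Local Notation V := 'rV[R]_n.
Implicit Types (u v : V -> R) (x y : V) (f g : R -> R).

(** The first derivative is required near [0], the second only at [0], without continuity. As a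
    relation it is stable under sums and under changes of [f] away from [0]. *)
Definition has_second_derivative f (l : R) := exists f1 : R -> R,
  (\forall t \near (0 : R), is_derive (t : R) 1 f (f1 t)) /\ is_derive (0 : R) 1 f1 l.

Lemma has_second_derivativeD f g l k : has_second_derivative f l ->
  has_second_derivative g k -> has_second_derivative (fun t => f t + g t) (l + k).
Proof.
move=> [f1 [nf f1l]] [g1 [ng g1k]]; exists (fun t => f1 t + g1 t); split.
  by near=> t; apply: is_derive_addf; near: t.
exact: is_derive_addf.
Unshelve. all: by end_near. Qed.

Lemma has_second_derivativeZ f l c : has_second_derivative f l ->
  has_second_derivative (fun t => c * f t) (c * l).
Proof.
move=> [f1 [nf f1l]]; exists (fun t => c * f1 t); split.
  near=> t; have ft : is_derive t 1 f (f1 t) by near: t.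
  by apply: is_derive_eq (is_derive_mulf (is_derive_cstf c t) ft) _; rewrite mul0r add0r.
by apply: is_derive_eq (is_derive_mulf (is_derive_cstf c 0) f1l) _; rewrite mul0r add0r.
Unshelve. all: by end_near. Qed.

(** A nonzero first derivative at [0] would contradict maximality on one side. If [l > 0], the first
    derivative is then positive just after [0], and the mean value theorem gives a value above
    [f 0]. *)
Lemma has_second_derivative_max f l : has_second_derivative f l ->
  (\forall t \near (0 : R), f t <= f 0) -> l <= 0.
Proof.
move=> [f1 [nf f1l]] fmax.
have [d /= d0 Hd] : exists2 d : R, 0 < d &
    forall t : R, `|t| < d -> is_derive t 1 f (f1 t) /\ f t <= f 0.
  have [d /= d0 Hd] : \forall t \near (0 : R), is_derive (t : R) 1 f (f1 t) /\ f t <= f 0.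
    by near=> t; split; near: t.
  by exists d => // t td; apply: Hd; rewrite /= sub0r normrN.
have half (e : R) : 0 < e -> exists2 h : R, 0 < h & h < d /\ h < e.
  move=> e0; exists (Num.min d e / 2); first by rewrite divr_gt0// lt_min d0.
  have m0 : 0 < Num.min d e by rewrite lt_min d0.
  have [h1 h2] : Num.min d e <= d /\ Num.min d e <= e by rewrite !ge_min !lexx orbT.
  by lra.
have [f0 _] : is_derive (0 : R) 1 f (f1 0) /\ f 0 <= f 0 by apply: Hd; rewrite normr0.
have f10 : f1 0 = 0.
  case: (ltgtP (f1 0) 0) => // h.
    have [|e e0 He] := derive_gt0_near (is_derive_oppf f0); first by rewrite oppr_gt0.
    have [k k0 [kd ke]] := half e e0.
    have /He : 0 < k < e by rewrite k0.
    have [_] : is_derive (- k) 1 f (f1 (- k)) /\ f (- k) <= f 0.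
      by apply: Hd; rewrite normrN gtr0_norm.
    by rewrite sub0r => h1 /andP[h2 _]; lra.
  have [|e e0 He] := derive_gt0_near f0; first by [].
  have [k k0 [kd ke]] := half e e0.
  have /He : 0 < k < e by rewrite k0.
  have [_] : is_derive k 1 f (f1 k) /\ f k <= f 0 by apply: Hd; rewrite gtr0_norm.
  by rewrite (add0r k) => h1 /andP[_ h2]; lra.
rewrite leNgt; apply/negP => l0.
have [e e0 He] := derive_gt0_near f1l l0.
have [k k0 [kd ke]] := half e e0.
have [_ fk] : is_derive k 1 f (f1 k) /\ f k <= f 0 by apply: Hd; rewrite gtr0_norm.
have [t /andP[t0 tk]] : exists2 c, 0 < c < k & f k - f 0 = f1 c * (k - 0).
  apply: mean_value => // t /andP[t0 tk].
  suff [] : is_derive t 1 f (f1 t) /\ f t <= f 0 by [].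
  by apply: Hd; rewrite ger0_norm//; lra.
rewrite subr0 => E.
have /He/andP[_] : 0 < t < e by lra.
rewrite (add0r t) f10 => f1t.
by have := mulr_gt0 f1t k0; lra.
Unshelve. all: by end_near. Qed.

Lemma has_second_derivative_cst c : has_second_derivative (fun=> c) 0.
Proof.
exists (fun=> 0); split; last exact: is_derive_cstf.
by near=> t; exact: is_derive_cstf.
Unshelve. all: by end_near. Qed.

(* Second derivatives along the coordinate lines, which avoids the total
   operator 'D_v in the computations. *)
Definition has_laplacian u x (L : R) := exists l : 'I_n -> R,
  (forall i, has_second_derivative (fun t => u (t *: delta_mx 0 i + x)) (l i))
  /\ \sum_i l i = L.

Lemma has_laplacianD u v x L M : has_laplacian u x L -> has_laplacian v x M ->
  has_laplacian (fun z => u z + v z) x (L + M).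
Proof.
move=> [l [ul <-]] [k [vk <-]]; exists (fun i => l i + k i); split.
  by move=> i; exact: has_second_derivativeD.
by rewrite big_split.
Qed.

Lemma has_laplacianZ u x L c : has_laplacian u x L ->
  has_laplacian (fun z => c * u z) x (c * L).
Proof.
move=> [l [ul <-]]; exists (fun i => c * l i); split.
  by move=> i; exact: has_second_derivativeZ.
by rewrite mulr_sumr.
Qed.

Lemma has_laplacian_cst c x : has_laplacian (fun=> c) x 0.
Proof.
exists (fun=> 0); split; last by rewrite big1.
by move=> i; exact: has_second_derivative_cst.
Qed.

Lemma has_laplacian_sum (I : Type) (s : seq I) (P : pred I) (F : I -> V -> R) x :
  (forall i, P i -> has_laplacian (F i) x 0) ->
  has_laplacian (fun z => \sum_(i <- s | P i) F i z) x 0.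
Proof.
move=> HF; elim: s => [|i s IH].
  rewrite (_ : (fun z => _) = (fun=> 0)); first exact: has_laplacian_cst.
  by apply/funext => z; rewrite big_nil.
case Pi : (P i).
- rewrite (_ : (fun z => _) = (fun z => F i z + \sum_(j <- s | P j) F j z)).
    by have := has_laplacianD (HF i Pi) IH; rewrite addr0.
  by apply/funext => z; rewrite big_cons Pi.
- rewrite (_ : (fun z => _) = (fun z => \sum_(j <- s | P j) F j z))//.
  by apply/funext => z; rewrite big_cons Pi.
Qed.

Lemma line_near (A : set V) x (e : V) : open A -> A x ->
  \forall t \near (0 : R), A (t *: e + x).
Proof.
move=> oA Ax; have : (fun t : R => t *: e + x) @ (0 : R) --> (0 *: e + x : V).
  by apply: cvgD; [exact: cvgZr_tmp|exact: cvg_cst].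
by apply; rewrite scale0r add0r; apply: open_nbhs_nbhs.
Qed.

Lemma harmonic_has_laplacian (A : set V) u x : open A -> harmonic_on A u -> A x ->
  has_laplacian u x 0.
Proof.
move=> oA [Cu Lu] Ax; exists (fun i => 'D_(delta_mx 0 i) ('D_(delta_mx 0 i) u) x).
split; last exact: Lu.
move=> i; exists (fun t => 'D_(delta_mx 0 i) u (t *: delta_mx 0 i + x)); split.
  near=> t; apply: is_derive_line; apply/derivableP.
  have At : A (t *: delta_mx 0 i + x) by near: t; exact: line_near.
  by have [_] := Cu [::] isT _ At; exact.
have dx : is_derive (0 *: delta_mx 0 i + x) (delta_mx 0 i) ('D_(delta_mx 0 i) u)
    ('D_(delta_mx 0 i) ('D_(delta_mx 0 i) u) x).
  rewrite scale0r add0r; apply/derivableP.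
  by have [_] := Cu [:: delta_mx 0 i] isT _ Ax; exact.
exact: is_derive_line dx.
Unshelve. all: by end_near. Qed.

End LineLaplacian.

(** * Euclidean geometry and topology of the annulus *)

Section EuclideanNorm.
Variables (R : realType) (n : nat).
Local Notation V := 'rV[R]_n.
Implicit Types x y z : V.

Definition dotp x y : R := \sum_i x 0 i * y 0 i.

Lemma dotpC x y : dotp x y = dotp y x.
Proof. by apply: eq_bigr => i _; rewrite mulrC. Qed.

Lemma dotpDl x y z : dotp (x + y) z = dotp x z + dotp y z.
Proof. by rewrite -big_split; apply: eq_bigr => i _; rewrite mxE mulrDl. Qed.

Lemma dotpZl c x y : dotp (c *: x) y = c * dotp x y.
Proof. by rewrite mulr_sumr; apply: eq_bigr => i _; rewrite mxE mulrA. Qed.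

Lemma dotpDr x y z : dotp z (x + y) = dotp z x + dotp z y.
Proof. by rewrite !(dotpC z) dotpDl. Qed.

Lemma dotpZr c x y : dotp x (c *: y) = c * dotp x y.
Proof. by rewrite !(dotpC x) dotpZl. Qed.

Lemma dotp_delta i x : dotp (delta_mx 0 i) x = x 0 i.
Proof.
rewrite /dotp (bigD1 i)//= mxE !eqxx mul1r big1 ?addr0// => j ji.
by rewrite mxE (negbTE ji) andbF mul0r.
Qed.

Lemma dotp_ge0 x : 0 <= dotp x x.
Proof. by apply: sumr_ge0 => i _; rewrite -expr2 sqr_ge0. Qed.

Lemma enorm_sqr x : enorm x ^+ 2 = dotp x x.
Proof. by rewrite /enorm sqr_sqrtr//; exact: dotp_ge0. Qed.

Lemma enorm_ge0 x : 0 <= enorm x.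
Proof. exact: sqrtr_ge0. Qed.

Lemma enorm_gt0 x : x <> 0 -> 0 < enorm x.
Proof.
move=> x0; rewrite lt_def enorm_ge0 andbT; apply/eqP => e0; apply: x0.
have := enorm_sqr x; rewrite e0 expr0n/= => /esym/eqP.
rewrite psumr_eq0; last by move=> i _; rewrite -expr2 sqr_ge0.
move=> /allP h; apply/rowP => i; rewrite mxE.
by have := h i; rewrite mem_index_enum mulf_eq0 orbb => /(_ isT)/eqP.
Qed.

Lemma dotp_sub_sqr c d x y :
  dotp (c *: x - d *: y) (c *: x - d *: y) =
  c ^+ 2 * dotp x x - 2 * (c * d) * dotp x y + d ^+ 2 * dotp y y.
Proof.
rewrite -scaleNr !(dotpDl, dotpDr, dotpZl, dotpZr) (dotpC y x); ring.
Qed.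

Lemma dotp_le x y : dotp x y <= enorm x * enorm y.
Proof.
have [->|/eqP x0] := eqVneq x 0.
  by rewrite /dotp big1 ?mulr_ge0 ?enorm_ge0// => i _; rewrite mxE mul0r.
have [->|/eqP y0] := eqVneq y 0.
  by rewrite /dotp big1 ?mulr_ge0 ?enorm_ge0// => i _; rewrite mxE mulr0.
have xy : 0 < enorm x * enorm y by rewrite mulr_gt0// enorm_gt0.
(* This square equals [2 |x| |y| (|x| |y| - x.y)], which yields Cauchy-Schwarz after division. *)
have := dotp_ge0 (enorm y *: x - enorm x *: y).
rewrite dotp_sub_sqr -!enorm_sqr => h.
have {}h : 0 <= (enorm x * enorm y) * (enorm x * enorm y - dotp x y).
  rewrite mulrBr; lra.
by move: h; rewrite pmulr_rge0// subr_ge0.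
Qed.

Lemma enorm_scale c x : enorm (c *: x) = `|c| * enorm x.
Proof.
apply/eqP; rewrite -(@eqrXn2 _ 2)// ?mulr_ge0 ?enorm_ge0//.
by rewrite enorm_sqr dotpZl dotpZr exprMn enorm_sqr real_normK ?num_real// mulrA -expr2.
Qed.

Lemma continuous_coordinate i : continuous (fun x : V => x 0 i).
Proof. exact: coord_continuous. Qed.

Lemma continuous_dotp y : continuous (fun x => dotp x y).
Proof.
apply: continuous_big => [|i _ x]; first exact: add_continuous.
apply: (continuous_comp (f := fun z : V => z 0 i) (g := fun t : R => t * y 0 i)).
  exact: continuous_coordinate.
exact: mulrr_continuous.
Qed.

Lemma continuous_dotp_diag : continuous (fun x : V => dotp x x).
Proof.
apply: continuous_big => [|i _ x]; first exact: add_continuous.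
apply: (continuous_comp (f := fun z : V => z 0 i) (g := fun t : R => t * t)).
  exact: continuous_coordinate.
exact: (cvgM cvg_id cvg_id).
Qed.

Lemma continuous_enorm : continuous (@enorm R n).
Proof.
move=> x; apply: (continuous_comp (f := fun x : V => dotp x x)).
  exact: continuous_dotp_diag.
exact: sqrt_continuous.
Qed.

End EuclideanNorm.

Section Annulus.
Variables (R : realType) (n : nat) (a : R).
Local Notation V := 'rV[R]_n.
Implicit Types x y z : V.

Lemma open_annulus : open (annulus n a).
Proof.
rewrite (_ : annulus n a = @enorm R n @^-1` `]a, 1[%classic).
  apply: open_comp; last exact: itv_open.
  by move=> x _; exact: continuous_enorm.
by apply/seteqP; split => x /=; rewrite in_itv.
Qed.

Lemma closure_annulus_sub : closure (annulus n a) `<=` [set x | a <= enorm x <= 1].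
Proof.
have cl : closed [set x : V | a <= enorm x <= 1].
  rewrite (_ : [set x : V | _] = @enorm R n @^-1` `[a, 1]%classic).
    apply: closed_comp; last exact: itv_closed.
    by move=> x _; exact: continuous_enorm.
  by apply/seteqP; split => x /=; rewrite in_itv.
rewrite [X in _ `<=` X](iffLR (closure_id _) cl).
apply: closure_subset => x /= /andP[h1 h2].
by rewrite !ltW.
Qed.

Lemma boundary_annulus x : (closure (annulus n a) `\` annulus n a) x ->
  enorm x = a \/ enorm x = 1.
Proof.
move=> [/closure_annulus_sub/= /andP[ax x1] nx].
have [|xa] := eqVneq (enorm x) a; first by left.
have [|x1'] := eqVneq (enorm x) 1; first by right.
by case: nx; rewrite /annulus/= !lt_neqAle ax x1 eq_sym xa x1'.
Qed.

Lemma coordinate_le_enorm x i : `|x 0 i| <= enorm x.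
Proof.
rewrite -(@ler_pXn2r _ 2)// ?nnegrE ?enorm_ge0// enorm_sqr real_normK ?num_real//.
rewrite /dotp (bigD1 i)//= -expr2 lerDl; apply: sumr_ge0 => j _.
by rewrite -expr2 sqr_ge0.
Qed.

Lemma compact_closure_annulus : compact (closure (annulus n a)).
Proof.
apply: bounded_closed_compact; last exact: closed_closure.
exists 1; split => // M M1 x /closure_annulus_sub/= /andP[_ x1].
rewrite [leLHS]/Num.norm/= mx_normrE; apply: bigmax_le => [|[i j] _]; first lra.
rewrite ord1; apply: le_trans (coordinate_le_enorm _ _) _; lra.
Qed.

End Annulus.

(** * Harmonicity of the potentials and the maximum principle *)

Section Laplacians.
Variables (R : realType).

Lemma dotp_line n (x : 'rV[R]_n) i (t : R) :
  let z := t *: delta_mx 0 i + x in dotp z z = dotp x x + 2 * x 0 i * t + t ^+ 2.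
Proof.
rewrite /= !(dotpDl, dotpDr, dotpZl, dotpZr) (dotpC x (delta_mx 0 i)).
rewrite !dotp_delta mxE !eqxx /=; ring.
Qed.

Lemma has_laplacian_dotp n (x : 'rV[R]_n) :
  has_laplacian (fun z => dotp z z) x (2 * n%:R).
Proof.
exists (fun=> 2); split; last by rewrite sumr_const card_ord mulr_natr.
move=> i; exists (fun t => 2 * x 0 i + 2 * t); split; last first.
  apply: is_derive_eq (is_derive_addf (is_derive_cstf (2 * x 0 i) 0)
    (is_derive_mulf (is_derive_cstf 2 0) (is_derive_idf 0))) _; rewrite /=; ring.
near=> t.
have -> : (fun s => dotp (s *: delta_mx 0 i + x) (s *: delta_mx 0 i + x)) =
    (fun s => dotp x x + 2 * x 0 i * s + s ^+ 2).
  by apply/funext => s; exact: dotp_line.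
apply: is_derive_eq (is_derive_addf (is_derive_addf (is_derive_cstf (dotp x x) t)
  (is_derive_mulf (is_derive_cstf (2 * x 0 i) t) (is_derive_idf t)))
  (is_derive_expf 2 (is_derive_idf t))) _; rewrite /=; ring.
Unshelve. all: by end_near. Qed.

Definition qform n (al ga : R) (y x : 'rV[R]_n) := al * dotp x x - 2 * dotp x y + ga.

(* When al * ga = |y|^2, the form is al |x - y / al|^2. *)
Lemma has_laplacian_potential m (al ga : R) (x y : 'rV[R]_m.+2) :
  al * ga = dotp y y -> 0 < qform al ga y x ->
  has_laplacian (fun z => potential m (qform al ga y z)) x 0.
Proof.
move=> alga; set q0 := qform al ga y x => q00.
pose q1 i := 2 * al * x 0 i - 2 * y 0 i.
pose q i (t : R) : R := q0 + q1 i * t + al * t ^+ 2.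
have qE i : (fun t => potential m (qform al ga y (t *: delta_mx 0 i + x))) =
            (fun t => potential m (q i t)).
  apply/funext => t; congr potential; rewrite /qform dotp_line dotpDl dotpZl dotp_delta.
  by rewrite /q /q0 /qform /q1; ring.
have dq i (t : R) : is_derive t 1 (q i) (q1 i + 2 * al * t).
  apply: is_derive_eq (is_derive_addf (is_derive_addf (is_derive_cstf q0 t)
    (is_derive_mulf (is_derive_cstf (q1 i) t) (is_derive_idf t)))
    (is_derive_mulf (is_derive_cstf al t) (is_derive_expf 2 (is_derive_idf t)))) _.
  by rewrite /=; ring.
have q_gt0 i : \forall t \near (0 : R), 0 < q i t.
  have cq : q i t @[t --> (0 : R)] --> q i 0.
    apply: differentiable_continuous; apply/derivable1_diffP.
    by have [] := dq i 0.
  by move: cq => /cvgr_gt; apply; rewrite /q mulr0 expr0n/= mulr0 !addr0.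
pose P := powhalf m q0.
exists (fun i => (m%:R / 2 + 1) / 2 * P / q0 ^+ 2 * q1 i ^+ 2 - al * P / q0); split.
  move=> i; rewrite qE.
  exists (fun t => - (powhalf m (q i t) / (2 * q i t)) * (q1 i + 2 * al * t)); split.
    near=> t; have qt : 0 < q i t by near: t; exact: q_gt0.
    exact: (is_derive_compf (g := q i) (is_derive_potential m qt) (dq i t)).
  have q0E : q i 0 = q0 by rewrite /q; ring.
  have q00' : 0 < q i 0 by rewrite q0E.
  have dP := is_derive_compf (g := q i) (is_derive_powhalf m q00') (dq i 0).
  have d2q := is_derive_mulf (is_derive_cstf 2 0) (dq i 0).
  have q2 : 2 * q i 0 != 0 by rewrite mulf_neq0// ?q0E gt_eqF.
  have d1 := is_derive_oppf (is_derive_mulf dP (is_derive_invf (f := fun t => 2 * q i t) (x := 0) q2 d2q)).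
  have d2 := is_derive_addf (is_derive_cstf (q1 i) 0)
    (is_derive_mulf (is_derive_cstf (2 * al) 0) (is_derive_idf 0)).
  apply: is_derive_eq (is_derive_mulf d1 d2) _.
  rewrite q0E -/P; field; rewrite gt_eqF//.
(* The relation [al * ga = |y|^2] enters here: the squared gradient of the form is [4 al] times the
   form. The gradient part then sums to [(m + 2) al P / q0], which cancels the contribution of the
   [m + 2] pure second derivatives. *)
have Sq : \sum_i q1 i ^+ 2 = 4 * al * q0.
  transitivity (4 * (al ^+ 2 * dotp x x - 2 * al * dotp x y + dotp y y)).
    rewrite /dotp !mulr_sumr -sumrB -big_split /= mulr_sumr.
    by apply: eq_bigr => i _; rewrite /q1; ring.
  by rewrite -alga /q0 /qform; ring.
have nE : m.+2%:R = m%:R + 2 :> R by rewrite -addn2 natrD.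
rewrite sumrB -mulr_sumr Sq sumr_const card_ord -[_ *+ m.+2]mulr_natl nE.
by field; rewrite gt_eqF.
Unshelve. all: by end_near. Qed.

(** Adding [d |z|^2] makes the Laplacian strictly positive, which excludes an interior maximum. *)
Lemma maximum_principle n (A : set 'rV[R]_n.+1) (u : 'rV[R]_n.+1 -> R) (M : R) :
  open A -> compact (closure A) -> {within closure A, continuous u} ->
  (forall x, A x -> has_laplacian u x 0) ->
  (forall x, closure A x -> ~ A x -> u x <= M) ->
  forall x, A x -> u x <= M.
Proof.
move=> oA cA cu hu bu x Ax; rewrite leNgt; apply/negP => Mux.
have clAx : closure A x by exact: subset_closure.
have [b _ bmax] := EVT_max_rV (ex_intro _ x clAx) cA
  (continuous_subspaceT (@continuous_dotp_diag R n.+1)).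
pose B := dotp b b + 1.
have B0 : 0 < B by rewrite /B ltr_wpDl// dotp_ge0.
have Bmax z : closure A z -> dotp z z < B.
  by move=> Az; apply: le_lt_trans (bmax z (mem_set Az)) _; rewrite /B ltrDl.
(* Small enough that the perturbation stays below half of the excess [u x - M] on the closure, so
   that no boundary point can reach [v x]. *)
pose d := (u x - M) / (2 * B).
have d0 : 0 < d by rewrite divr_gt0 ?mulr_gt0//; lra.
have dB : d * B = (u x - M) / 2 by rewrite /d; field; rewrite gt_eqF.
pose v z := u z + d * dotp z z.
have cv : {within closure A, continuous v}.
  move=> z; apply: cvgD; first exact: cu.
  apply: cvgM; first exact: cvg_cst.
  exact: (continuous_subspaceT (@continuous_dotp_diag R n.+1)).
have [c cAc cmax] := EVT_max_rV (ex_intro _ x clAx) cA cv.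
rewrite inE in cAc.
have xc : v x <= v c by apply: cmax; rewrite inE.
have Ac : A c.
  apply: contrapT => nAc; have := bu c cAc nAc.
  have : d * dotp c c < d * B by rewrite ltr_pM2l// Bmax.
  have : 0 <= d * dotp x x by rewrite mulr_ge0 ?dotp_ge0// ltW.
  by move: xc; rewrite /v; lra.
have := has_laplacianD (hu c Ac) (has_laplacianZ d (has_laplacian_dotp c)).
rewrite add0r => -[l [vl sl]].
have : \sum_i l i <= 0.
  apply: sumr_le0 => i _; apply: has_second_derivative_max (vl i) _.
  near=> t; rewrite scale0r add0r -!/(v _); apply: cmax; rewrite inE.
  by apply: subset_closure; near: t; exact: line_near.
by rewrite sl leNgt mulr_gt0// mulr_gt0// ltr0n.
Unshelve. all: by end_near. Qed.

End Laplacians.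

(** * Area of the unit sphere *)

Section UnitSphereArea.
Variable R : realType.
Local Notation tupleR n := (n.-tuple (measurableTypeR R)).

Definition cube n (c d : R) : set (tupleR n) := [set t | forall i, c < tnth t i <= d].

Lemma tuple_cons_cube n c d :
  @tuple_cons R n @^-1` cube c d = `]c, d]%classic `*` cube c d.
Proof.
apply/seteqP; split => [[x t] h|[x t] [hx ht]] /=.
  split => /=; first by have := h ord0; rewrite in_itv.
  by move=> i; have := h (lift ord0 i); rewrite tnthS.
move=> i; case: (unliftP ord0 i) => [j ->|->]; first by rewrite tnthS; exact: ht.
by move: hx; rewrite /= in_itv.
Qed.

Lemma measurable_cube n c d : measurable (@cube n c d).
Proof.
rewrite (_ : cube c d = \bigcap_(i in [set: 'I_n]) ((@tnth n _)^~ i @^-1` `]c, d]%classic)).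
  apply: fin_bigcap_measurable => [|i _]; first exact: finite_finset.
  have mt : measurable_fun [set: tupleR n] ((@tnth n _)^~ i) by exact: measurable_tnth.
  by rewrite -[X in measurable X]setTI; apply: mt => //; exact: measurable_itv.
apply/seteqP; split => t h i.
  by move=> _ /=; rewrite in_itv; exact: h.
by have := h i I; rewrite /= in_itv.
Qed.

Lemma lebesgue_measure_cube n (c d : R) : c <= d ->
  lebesgue_measure_tuple R n (cube c d) = ((d - c) ^+ n)%:E.
Proof.
move=> cd; elim: n => [|n IH] /=.
  have h : cube c d ([tuple] : tupleR 0) by case.
  by rewrite diracE (mem_set h) expr0.
have hm : (@lebesgue_measure R `]c, d]%classic = (d - c)%:E)%E.
  rewrite lebesgue_measure_itv/= lte_fin; case: ltP => dc; first by rewrite -EFinB.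
  by rewrite (_ : d = c) ?subrr//; lra.
rewrite /lebesgue_step /pushforward tuple_cons_cube.
apply: etrans (product_measure1E _ _ _ _) _ => //; first exact: measurable_cube.
rewrite exprS EFinM -IH; congr (_ * _)%E; exact: hm.
Qed.

Lemma enorm_row_of_tuple n (t : tupleR n) :
  enorm (row_of_tuple t) ^+ 2 = \sum_i tnth t i ^+ 2.
Proof. by rewrite enorm_sqr; apply: eq_bigr => i _; rewrite mxE expr2. Qed.

(** The cone over the whole sphere is the closed unit ball without its centre, a preimage of []0,
    1]] under the sum of squares. *)
Lemma measurable_unit_cone n : measurable [set t : tupleR n |
  exists s u, [/\ 0 < s <= 1, enorm u = 1 & row_of_tuple t = s *: u]].
Proof.
rewrite (_ : [set t | _] = (fun t : tupleR n => \sum_i tnth t i ^+ 2) @^-1` `]0, 1]%classic).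
  have ms : measurable_fun [set: tupleR n] (fun t => \sum_i tnth t i ^+ 2).
    by apply: measurable_sum => i; apply: measurable_realfun.measurable_funX; exact: measurable_tnth.
  by rewrite -[X in measurable X]setTI; apply: ms => //; exact: measurable_itv.
apply/seteqP; split => t.
  move=> [s [u [/andP[s0 s1] u1 tE]]] /=; rewrite in_itv/= -enorm_row_of_tuple tE.
  by rewrite enorm_scale u1 mulr1 gtr0_norm// exprn_gt0//= exprn_ile1// ltW.
rewrite /= in_itv/= -enorm_row_of_tuple => /andP[t0 t1].
set r := enorm (row_of_tuple t) in t0 t1 *.
have r0 : 0 < r.
  by rewrite lt_def enorm_ge0 andbT; apply: contraTneq t0 => ->; rewrite expr0n ltxx.
exists r, (r^-1 *: row_of_tuple t); split.
- by rewrite r0; rewrite -(expr1n _ 2) ler_pXn2r ?nnegrE// in t1; exact: ltW.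
- by rewrite enorm_scale gtr0_norm ?invr_gt0// mulVf// gt_eqF.
- by rewrite scalerA mulfV ?scale1r// gt_eqF.
Qed.

(** Ensures that the fundamental solution is a positive multiple of [potential]. As [fine] sends
    infinity to [0], the measure must be shown finite as well as positive: the cone is squeezed
    between two cubes. *)
Lemma unit_sphere_area_gt0 n : (0 < n)%N -> 0 < unit_sphere_area R n.
Proof.
move=> n0; have nR : 0 < n%:R :> R by rewrite ltr0n.
rewrite /unit_sphere_area mulr_gt0//; set C := [set t | _].
have mC : measurable C by exact: measurable_unit_cone.
apply: fine_gt0; apply/andP; split.
  have : (lebesgue_measure_tuple R n (cube 0 n%:R^-1) <= lebesgue_measure_tuple R n C)%E.
    apply: le_measure; rewrite ?inE//; first exact: measurable_cube.
    move=> t tE; set r := enorm (row_of_tuple t).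
    have r2 : 0 < r ^+ 2 <= 1.
      rewrite enorm_row_of_tuple; apply/andP; split.
        rewrite (bigD1 (Ordinal n0))//= ltr_pwDl//.
          by rewrite exprn_gt0//; case/andP: (tE (Ordinal n0)).
        by apply: sumr_ge0 => i _; rewrite sqr_ge0.
      apply: (@le_trans _ _ (\sum_(i < n) n%:R^-1)); last first.
        by rewrite sumr_const card_ord -[_ *+ n]mulr_natl mulfV// gt_eqF.
      apply: ler_sum => i _; have /andP[h1 h2] := tE i.
      have h3 : n%:R^-1 <= 1 :> R by rewrite invf_le1// ler1n.
      by rewrite expr2; apply: le_trans (ler_pM _ _ h2 (le_trans h2 h3)) _; rewrite ?mulr1// ltW.
    have /andP[r20 r21] := r2.
    have r0 : 0 < r.
      by rewrite lt_def enorm_ge0 andbT; apply: contraTneq r20 => ->; rewrite expr0n ltxx.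
    exists r, (r^-1 *: row_of_tuple t); split.
    - by rewrite r0; rewrite -(expr1n _ 2) ler_pXn2r ?nnegrE// in r21; exact: ltW.
    - by rewrite enorm_scale gtr0_norm ?invr_gt0// mulVf// gt_eqF.
    - by rewrite scalerA mulfV ?scale1r// gt_eqF.
  have ninv : 0 < n%:R^-1 :> R by rewrite invr_gt0.
  rewrite (lebesgue_measure_cube _ (ltW ninv)) subr0; apply: lt_le_trans.
  by rewrite lte_fin exprn_gt0// invr_gt0.
(* The cubes are open on the left, so [-2] leaves room for a coordinate equal to [-1]. *)
have : (lebesgue_measure_tuple R n C <= lebesgue_measure_tuple R n (cube (-2) 1))%E.
  apply: le_measure; rewrite ?inE//; first exact: measurable_cube.
  move=> t [s [u [/andP[s0 s1] u1 tE]]] i.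
  have : `|row_of_tuple t 0 i| <= 1.
    apply: le_trans (coordinate_le_enorm _ _) _.
    by rewrite tE enorm_scale u1 mulr1 gtr0_norm.
  by rewrite mxE ler_norml => /andP[h1 h2]; lra.
rewrite lebesgue_measure_cube; last lra.
by move=> h; apply: le_lt_trans h _; rewrite ltry.
Qed.

End UnitSphereArea.

(** * The method of images *)

Lemma expn_lt_eventually (R : realType) (q e : R) : 0 < q < 1 -> 0 < e ->
  exists N0, forall N, (N0 <= N)%N -> q ^+ N < e.
Proof.
move=> /andP[q0 q1] e0.
have /cvgr_lt/(_ _ e0) : q ^+ N @[N --> \oo] --> (0 : R).
  by apply: cvg_expr; rewrite gtr0_norm.
by case=> N0 _ H; exists N0 => N /H.
Qed.

Section PotentialFacts.
Variables (R : realType) (m : nat).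
Implicit Types s t c : R.

Lemma potentialE s : m%:R * potential m s = powhalf m s - 1.
Proof.
rewrite /potential; case: eqVneq => [->|m0]; last by field; rewrite pnatr_eq0.
by rewrite /powhalf !mul0r oppr0 mul0r expR0 subrr.
Qed.

(** One scaling law covers the additive logarithm and the multiplicative power. In a difference of
    two potentials with a common factor [c], the term [potential m c] cancels. *)
Lemma potentialM c s : 0 < c -> 0 < s ->
  potential m (c * s) = powhalf m c * potential m s + potential m c.
Proof.
move=> c0 s0; have := powhalfM m c0 s0; rewrite /potential.
case: eqVneq => [m0 _|m0 ->]; last by field; rewrite pnatr_eq0.
by rewrite lnM// /powhalf m0 !mul0r oppr0 mul0r expR0; field.
Qed.

Lemma continuous_potential s : 0 < s -> {for s, continuous (@potential R m)}.
Proof.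
move=> s0; apply: differentiable_continuous; apply/derivable1_diffP.
by have [] := is_derive_potential m s0.
Qed.

Lemma potential_near s e : 0 < s -> 0 < e ->
  exists2 d, 0 < d & forall t, `|t - s| < d -> `|potential m t - potential m s| < e.
Proof.
move=> s0 e0; have /cvgrPdist_lt/(_ _ e0)[d /= d0 Hd] := continuous_potential s0.
by exists d => // t td; rewrite distrC; apply: Hd; rewrite /= distrC.
Qed.

End PotentialFacts.

(* Filter instances are not inferred on the topology of 'rV[R]_n, hence these
   forms of library lemmas over an abstract topological type. *)
Section ContinuousAt.
Variables (R : realType) (T : topologicalType) (x : T).
Implicit Types f g : T -> R.

Lemma continuous_at_cst (c : R) : {for x, continuous (fun=> c : R)}.
Proof. exact: cvg_cst. Qed.

Lemma continuous_atD f g : {for x, continuous f} -> {for x, continuous g} ->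
  {for x, continuous (fun z => f z + g z)}.
Proof. exact: cvgD. Qed.

Lemma continuous_atB f g : {for x, continuous f} -> {for x, continuous g} ->
  {for x, continuous (fun z => f z - g z)}.
Proof. exact: cvgB. Qed.

Lemma continuous_atM f g : {for x, continuous f} -> {for x, continuous g} ->
  {for x, continuous (fun z => f z * g z)}.
Proof. exact: cvgM. Qed.

Lemma continuous_at_sum (I : Type) (s : seq I) (P : pred I) (F : I -> T -> R) :
  (forall i, P i -> {for x, continuous (F i)}) ->
  {for x, continuous (fun z => \sum_(i <- s | P i) F i z)}.
Proof.
move=> cF; elim: s => [|i s IH].
  rewrite (_ : (fun z => _) = (fun=> 0)); first exact: continuous_at_cst.
  by apply/funext => z; rewrite big_nil.
case Pi : (P i).
- rewrite (_ : (fun z => _) = (fun z => F i z + \sum_(j <- s | P j) F j z)).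
    by apply: continuous_atD => //; exact: cF.
  by apply/funext => z; rewrite big_cons Pi.
- rewrite (_ : (fun z => _) = (fun z => \sum_(j <- s | P j) F j z))//.
  by apply/funext => z; rewrite big_cons Pi.
Qed.

End ContinuousAt.

Section Images.
Variables (R : realType) (m : nat) (a : R).
Hypothesis a01 : 0 < a < 1.
Local Notation V := 'rV[R]_m.+2.
Implicit Types (x y : V) (b : R).

Definition scaled_term b y x :=
  potential m (qform (b ^- 2) (b ^+ 2 * dotp y y) y x).
Definition kelvin_term b y x :=
  potential m (qform (dotp y y / b ^+ 2) (b ^+ 2) y x).

(* Image parameters a^(i - N), for 0 <= i <= 2 N + 1. *)
Definition image_ratio N i : R := a ^+ i / a ^+ N.

(* Only the planar logarithm needs a correction: the truncated sums of images
   do not tend to zero on |x| = a when m = 0. *)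
Definition planar_coef : R := (m == 0%N)%:R / potential m (a ^+ 2).

(** Approximates [-H] up to normalisation, whence the plus sign on the Kelvin images. The omitted
    index [i = N] has ratio [1]: it is the singular term [potential m (|x - y|^2)] itself. *)
Definition image_sum N y x :=
  \sum_(i < (N + N).+1) kelvin_term (image_ratio N i) y x
  - \sum_(i < (N + N).+1 | i != N :> nat) scaled_term (image_ratio N i) y x
  + planar_coef * potential m (dotp x x) * potential m (dotp y y).

Lemma image_ratio_gt0 N i : 0 < image_ratio N i.
Proof. by have /andP[a0 _] := a01; rewrite divr_gt0 ?exprn_gt0. Qed.

Lemma image_ratioN N : image_ratio N N = 1.
Proof. by have /andP[a0 _] := a01; rewrite /image_ratio mulfV// expf_neq0// gt_eqF. Qed.

Lemma image_ratioS N i : image_ratio N i.+1 = a * image_ratio N i.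
Proof. by rewrite /image_ratio exprS mulrA. Qed.

Lemma image_ratio_lt N i j : (i < j)%N -> image_ratio N j <= a * image_ratio N i.
Proof.
move=> ij; have /andP[a0 a1] := a01; rewrite -image_ratioS.
rewrite ler_pM2r ?invr_gt0 ?exprn_gt0//; apply: ler_wiXn2l => //; lra.
Qed.

Lemma image_ratio_outer N i : (i <= N)%N -> 1 <= image_ratio N i.
Proof.
have /andP[a0 a1] := a01; rewrite leq_eqVlt => /predU1P[->|iN].
  by rewrite image_ratioN.
have := image_ratio_lt N iN; rewrite image_ratioN.
have := image_ratio_gt0 N i; set b := image_ratio N i => b0 h.
have : a * b <= b by rewrite ler_piMl; lra.
lra.
Qed.

Lemma image_ratio_outer_lt N i : (i < N)%N -> 1 <= a * image_ratio N i.
Proof. by move=> iN; have := image_ratio_lt N iN; rewrite image_ratioN. Qed.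

Lemma image_ratio_inner N i : (N < i)%N -> image_ratio N i <= a.
Proof. by move=> iN; have := image_ratio_lt N iN; rewrite image_ratioN mulr1. Qed.

Lemma qform_scaled_ge b y x : 0 < b ->
  (enorm x / b - b * enorm y) ^+ 2 <= qform (b ^- 2) (b ^+ 2 * dotp y y) y x.
Proof.
move=> b0; rewrite /qform -!enorm_sqr; have := dotp_le x y; move: (dotp x y) => p.
have -> : (enorm x / b - b * enorm y) ^+ 2 = b ^- 2 * enorm x ^+ 2
    - 2 * (enorm x * enorm y) + b ^+ 2 * enorm y ^+ 2 by field; rewrite gt_eqF.
lra.
Qed.

Lemma qform_kelvin_ge b y x : 0 < b ->
  (enorm x * enorm y / b - b) ^+ 2 <= qform (dotp y y / b ^+ 2) (b ^+ 2) y x.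
Proof.
move=> b0; rewrite /qform -!enorm_sqr; have := dotp_le x y; move: (dotp x y) => p.
have -> : (enorm x * enorm y / b - b) ^+ 2 = enorm y ^+ 2 / b ^+ 2 * enorm x ^+ 2
    - 2 * (enorm x * enorm y) + b ^+ 2 by field; rewrite gt_eqF.
lra.
Qed.

(** A zero forces [|x| = b^2 |y|]. The ratio [|x| / |y|] lies strictly between [a] and [1/a],
    whereas [b^2] is at most [a^2] or at least [a^-2]. *)
Lemma qform_scaled_gt0 N i y x : i != N -> a < enorm y < 1 -> a <= enorm x <= 1 ->
  0 < qform (image_ratio N i ^- 2) (image_ratio N i ^+ 2 * dotp y y) y x.
Proof.
move=> iN /andP[ay y1] /andP[ax x1]; have /andP[a0 a1] := a01; set b := image_ratio N i.
have b0 : 0 < b := image_ratio_gt0 N i.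
apply: lt_le_trans (qform_scaled_ge _ _ b0).
rewrite exprn_even_gt0//= subr_eq0; apply/eqP => E.
have {}E : enorm x = b ^+ 2 * enorm y by rewrite expr2 -mulrA -E mulrCA mulfV ?mulr1 ?gt_eqF.
case: (ltngtP i N) iN => // iN _.
- have h : 1 <= (a * b) ^+ 2 by rewrite exprn_ege1// image_ratio_outer_lt.
  have h2 : a * (a * enorm x) = (a * b) ^+ 2 * enorm y by rewrite E; ring.
  have h3 : enorm y <= (a * b) ^+ 2 * enorm y by rewrite ler_peMl//; lra.
  have h4 : a * (a * enorm x) <= a * (1 * 1) by rewrite ler_pM2l// ler_pM//; lra.
  lra.
- have h := image_ratio_inner iN; rewrite -/b in h.
  have h2 : b ^+ 2 <= a * 1 by rewrite expr2 ler_pM//; lra.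
  have : b ^+ 2 * enorm y < a * 1.
    apply: le_lt_trans (_ : a * enorm y < _); last by rewrite ltr_pM2l.
    by rewrite ler_pM2r//; lra.
  lra.
Qed.

(** A zero forces [|x| |y| = b^2], but [a^2 < |x| |y| < 1] while [b^2] is at least [1] or at most
    [a^2]. *)
Lemma qform_kelvin_gt0 N i y x : a < enorm y < 1 -> a <= enorm x <= 1 ->
  0 < qform (dotp y y / image_ratio N i ^+ 2) (image_ratio N i ^+ 2) y x.
Proof.
move=> /andP[ay y1] /andP[ax x1]; have /andP[a0 a1] := a01; set b := image_ratio N i.
have b0 : 0 < b := image_ratio_gt0 N i.
apply: lt_le_trans (qform_kelvin_ge _ _ b0).
rewrite exprn_even_gt0//= subr_eq0; apply/eqP => E.
move/(congr1 (fun t => t * b)): E; rewrite divfK ?gt_eqF// -expr2 => E.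
have h1 : enorm x * enorm y < 1 * 1.
  apply: le_lt_trans (_ : 1 * enorm y < _); last by rewrite !mul1r.
  by rewrite ler_pM2r//; lra.
have h2 : a * a < enorm x * enorm y.
  apply: lt_le_trans (_ : a * enorm y <= _); first by rewrite ltr_pM2l.
  by rewrite ler_pM2r//; lra.
case: (leqP i N) => iN.
- have : 1 <= b ^+ 2 by rewrite exprn_ege1// image_ratio_outer.
  lra.
- have h := image_ratio_inner iN; rewrite -/b in h.
  have : b ^+ 2 <= a * a by rewrite expr2 ler_pM//; lra.
  lra.
Qed.

Lemma continuous_qform_potential al ga y x : 0 < qform al ga y x ->
  {for x, continuous (fun z : V => potential m (qform al ga y z))}.
Proof.
move=> q0; apply: (continuous_comp (f := fun z : V => qform al ga y z)); last first.
  exact: continuous_potential.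
have h1 : {for x, continuous (fun z : V => dotp z z)} by exact: continuous_dotp_diag.
have h2 : {for x, continuous (fun z : V => dotp z y)} by exact: continuous_dotp.
apply: continuous_atD; last exact: continuous_at_cst.
by apply: continuous_atB; apply: continuous_atM => //; exact: continuous_at_cst.
Qed.

Lemma dotp_gt0 x : a <= enorm x -> 0 < dotp x x.
Proof.
by have /andP[a0 _] := a01; move=> ax; rewrite -enorm_sqr exprn_gt0//; lra.
Qed.

Lemma qform_normE x : dotp x x = qform 1 0 0 x.
Proof.
rewrite /qform mul1r addr0.
by rewrite [X in 2 * X](_ : _ = 0) ?mulr0 ?subr0// /dotp big1// => i _; rewrite mxE mulr0.
Qed.

Lemma qform_norm : (fun z : V => potential m (dotp z z)) =
  (fun z => potential m (qform 1 0 0 z)).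
Proof. by apply/funext => z; rewrite qform_normE. Qed.

Lemma continuous_image_sum N y x : a < enorm y < 1 -> a <= enorm x <= 1 ->
  {for x, continuous (image_sum N y)}.
Proof.
move=> hy hx; have /andP[ay _] := hy; have /andP[ax _] := hx.
apply: continuous_atD; first apply: continuous_atB.
- apply: continuous_at_sum => i _; apply: continuous_qform_potential.
  exact: qform_kelvin_gt0.
- apply: continuous_at_sum => i iN; apply: continuous_qform_potential.
  exact: qform_scaled_gt0.
- apply: continuous_atM; last exact: continuous_at_cst.
  apply: continuous_atM; first exact: continuous_at_cst.
  rewrite qform_norm; apply: continuous_qform_potential.
  by rewrite -qform_normE dotp_gt0.
Qed.

Lemma has_laplacian_image_sum N y x : a < enorm y < 1 -> a <= enorm x <= 1 ->
  has_laplacian (image_sum N y) x 0.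
Proof.
move=> hy hx; have /andP[ay _] := hy; have /andP[ax _] := hx.
have b0 i : image_ratio N i != 0 by rewrite gt_eqF// image_ratio_gt0.
have h1 : has_laplacian
    (fun z => \sum_(i < (N + N).+1) kelvin_term (image_ratio N i) y z) x 0.
  apply: has_laplacian_sum => i _; apply: has_laplacian_potential.
    by rewrite divfK// expf_neq0.
  exact: qform_kelvin_gt0.
have h2 : has_laplacian
    (fun z => \sum_(i < (N + N).+1 | i != N :> nat) scaled_term (image_ratio N i) y z) x 0.
  apply: has_laplacian_sum => i iN; apply: has_laplacian_potential.
    by rewrite mulKf// expf_neq0.
  exact: qform_scaled_gt0.
have h3 : has_laplacian (fun z => potential m (dotp z z)) x 0.
  rewrite qform_norm; apply: has_laplacian_potential.
    by rewrite mulr0 /dotp big1// => i _; rewrite mxE mulr0.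
  by rewrite -qform_normE dotp_gt0.
have := has_laplacianD (has_laplacianD h1 (has_laplacianZ (-1) h2))
  (has_laplacianZ (planar_coef * potential m (dotp y y)) h3).
rewrite !mulr0 !addr0; congr has_laplacian; apply/funext => z.
by rewrite /image_sum mulN1r; ring.
Qed.

Lemma potential_distE x y : scaled_term 1 y x = potential m (dotp (x - y) (x - y)).
Proof.
have := dotp_sub_sqr 1 1 x y; rewrite !scale1r /scaled_term /qform => ->.
by congr potential; rewrite !expr1n invr1 !mul1r mulr1.
Qed.

Lemma kelvin_scaled_term b c y x : b != 0 -> c != 0 -> b * c = enorm x ->
  kelvin_term b y x = scaled_term c y x.
Proof.
move=> b0 c0 bc; congr potential; rewrite /qform -!enorm_sqr -bc.
by field; rewrite b0 c0.
Qed.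

Lemma image_ratioM N i : (i <= N + N)%N ->
  image_ratio N i * image_ratio N (N + N - i) = 1.
Proof.
move=> iN; have /andP[a0 _] := a01; rewrite /image_ratio mulrACA -exprD subnKC//.
by rewrite exprD -invfM mulfV// mulf_neq0// expf_neq0// gt_eqF.
Qed.

Lemma sum_scaled_term N y x :
  \sum_(i < (N + N).+1) scaled_term (image_ratio N i) y x =
  potential m (dotp (x - y) (x - y)) +
    \sum_(i < (N + N).+1 | i != N :> nat) scaled_term (image_ratio N i) y x.
Proof.
have NN : (N < (N + N).+1)%N by rewrite ltnS leq_addr.
rewrite (bigD1 (Ordinal NN))//= image_ratioN potential_distE; congr (_ + _).
Qed.

(** The range of exponents [-N, ..., N] is symmetric under [b -> 1/b], so the cancellation is exact
    for every [N] and leaves only the omitted scaled term. *)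
Lemma image_sum_outer N y x : enorm x = 1 ->
  image_sum N y x = potential m (dotp (x - y) (x - y)).
Proof.
move=> x1; rewrite /image_sum -enorm_sqr x1 expr1n potential1 mulr0 mul0r addr0.
rewrite (reindex_inj rev_ord_inj)/=.
rewrite (eq_bigr (fun i : 'I_(N + N).+1 => scaled_term (image_ratio N i) y x)).
  by rewrite sum_scaled_term addrK.
move=> i _; apply: kelvin_scaled_term; rewrite ?gt_eqF ?image_ratio_gt0//.
by rewrite subSS mulrC image_ratioM// -ltnS.
Qed.

(** The pairing [b -> a/b] shifts the range of exponents by one, so the sums telescope and one
    scaled term survives at each end. *)
Lemma image_sum_inner N y x : enorm x = a ->
  image_sum N y x = potential m (dotp (x - y) (x - y))
    + (scaled_term (image_ratio N (N + N).+1) y x - scaled_term (image_ratio N 0) y x)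
    + planar_coef * potential m (a ^+ 2) * potential m (dotp y y).
Proof.
move=> xa; rewrite /image_sum -(enorm_sqr x) xa; congr (_ + _).
rewrite (reindex_inj rev_ord_inj)/=.
rewrite (eq_bigr (fun i : 'I_(N + N).+1 => scaled_term (image_ratio N i.+1) y x)); last first.
  move=> i _; apply: kelvin_scaled_term; rewrite ?gt_eqF ?image_ratio_gt0//.
  rewrite image_ratioS xa mulrCA subSS [X in _ * X = _]mulrC.
  by rewrite image_ratioM ?mulr1// -ltnS.
(* The same sum of [2 N + 2] terms, peeled at its last index on one side and at its first on the
   other, expresses the shifted sum. *)
have : \sum_(i < (N + N).+2) scaled_term (image_ratio N i) y x =
    \sum_(i < (N + N).+2) scaled_term (image_ratio N i) y x by [].
rewrite [LHS]big_ord_recr [RHS]big_ord_recl /= sum_scaled_term => E.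
rewrite (_ : \sum_(i < _) _ = potential m (dotp (x - y) (x - y)) +
    \sum_(i < (N + N).+1 | i != N :> nat) scaled_term (image_ratio N i) y x +
    scaled_term (image_ratio N (N + N).+1) y x - scaled_term (image_ratio N 0) y x).
  ring.
by rewrite E addrC addKr.
Qed.

Lemma potential_sqr_gt0 : 0 < potential m (a ^+ 2).
Proof.
have /andP[a0 a1] := a01; rewrite -(potential1 R m); apply: potential_decr.
  by rewrite exprn_gt0.
by rewrite exprn_ilt1// ltW.
Qed.

Lemma planar_coefE : planar_coef * potential m (a ^+ 2) = (m == 0%N)%:R.
Proof. by rewrite /planar_coef divfK// gt_eqF// potential_sqr_gt0. Qed.

Lemma scaled_term_inner_factor N y x : enorm x = a ->
  scaled_term (image_ratio N (N + N).+1) y x =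
  potential m ((a ^+ N) ^- 2 * (1 + (a ^+ N) ^+ 2 *
    (a ^+ 2 * (a ^+ N) ^+ 2 * dotp y y - 2 * dotp x y))).
Proof.
move=> xa; have /andP[a0 _] := a01.
rewrite /scaled_term /image_ratio /qform -(enorm_sqr x) xa [a ^+ (N + N).+1]exprS exprD.
have w0 : a ^+ N != 0 by rewrite expf_neq0// gt_eqF.
move: w0; set w := a ^+ N => w0; congr potential; field.
by rewrite w0 gt_eqF.
Qed.

Lemma scaled_term_outer_factor N y x : enorm x = a ->
  scaled_term (image_ratio N 0) y x =
  potential m ((a ^+ N) ^- 2 * (dotp y y + (a ^+ N) ^+ 2 *
    (a ^+ 2 * (a ^+ N) ^+ 2 - 2 * dotp x y))).
Proof.
move=> xa; have /andP[a0 _] := a01.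
rewrite /scaled_term /image_ratio /qform -(enorm_sqr x) xa expr0.
have w0 : a ^+ N != 0 by rewrite expf_neq0// gt_eqF.
by move: w0; set w := a ^+ N => w0; congr potential; field.
Qed.

Lemma dotp_bound x y : enorm x <= 1 -> enorm y <= 1 -> `|dotp x y| <= 1.
Proof.
move=> x1 y1; rewrite ler_norml.
have h : enorm x * enorm y <= 1 * 1 by rewrite ler_pM ?enorm_ge0.
have := dotp_le x y; have := dotp_le (-1 *: x) y.
rewrite dotpZl enorm_scale normrN normr1 mul1r; lra.
Qed.

(** With [w = a^N], the two end terms have arguments [w^-2 (1 + u1)] and [w^-2 (|y|^2 + u2)] with
    [u1], [u2] tending to [0]. By [potentialM] their difference carries the factor [w^m]. It
    vanishes in the limit for [m > 0]; for [m = 0] it tends to [- potential m (|y|^2)], which the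
    planar correction compensates. *)
Lemma image_sum_inner_error y e : a < enorm y < 1 -> 0 < e ->
  exists N0, forall N, (N0 <= N)%N -> forall x, enorm x = a ->
    `|image_sum N y x - potential m (dotp (x - y) (x - y))| <= e.
Proof.
move=> /andP[ay y1] e0; have /andP[a0 a1] := a01.
have yy0 : 0 < dotp y y by apply: dotp_gt0; lra.
have yy1 : dotp y y <= 1.
  by rewrite -enorm_sqr exprn_ile1// ?enorm_ge0//; lra.
have e20 : 0 < e / 2 by lra.
have [d1 d10 Hd1] := potential_near m (@ltr01 R) e20.
have [d2 d20 Hd2] := potential_near m yy0 e20.
pose M := `|potential m (dotp y y)| + e.
have M0 : 0 < M by rewrite /M ltr_wpDl.
(* Both perturbations are at most [3 w]: the quarters put them within [d1] and [d2] and, as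
   [|y| <= 1], keep [1 + u1] and [|y|^2 + u2] positive. The bound [e / M] gives [w M <= e] when
   [m > 0]. *)
pose k := Num.min (Num.min (d1 / 4) (d2 / 4)) (Num.min (e / M) (dotp y y / 4)).
have k0 : 0 < k by rewrite /k !lt_min !divr_gt0//.
have : k <= k by []. rewrite {2}/k !le_min => /andP[/andP[k1 k2] /andP[k3 k4]].
have [N0 HN0] := expn_lt_eventually a01 k0.
exists N0 => N /HN0; set w := a ^+ N => wk x xa.
have w0 : 0 < w by rewrite exprn_gt0.
have w1 : w <= 1 by rewrite exprn_ile1// ltW.
have w2 : w ^+ 2 <= w by rewrite expr2 ler_piMr// ltW.
have w20 : 0 < w ^+ 2 by rewrite exprn_gt0.
rewrite image_sum_inner// planar_coefE scaled_term_inner_factor//.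
rewrite scaled_term_outer_factor// -/w.
have p1 : `|dotp x y| <= 1 by apply: dotp_bound; lra.
have aw : 0 <= a ^+ 2 * w ^+ 2 <= 1.
  have h : a ^+ 2 <= 1 by rewrite exprn_ile1// ltW.
  have h' : w ^+ 2 <= 1 by rewrite exprn_ile1// ltW.
  by rewrite mulr_ge0 ?sqr_ge0//= mulr_ile1 ?sqr_ge0.
have awy : 0 <= a ^+ 2 * w ^+ 2 * dotp y y <= 1.
  by case/andP: aw => h1 h2; rewrite mulr_ge0 ?dotp_ge0//= mulr_ile1// dotp_ge0.
have bound u : 0 <= u <= 1 -> `|w ^+ 2 * (u - 2 * dotp x y)| <= 3 * w.
  move=> u1; rewrite normrM gtr0_norm// mulrC.
  apply: ler_pM => //; first exact: ltW.
  by move: p1; rewrite !ler_norml; lra.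
have b1 := bound _ awy; have b2 := bound _ aw; clear bound.
move: b1 b2; set u1 := w ^+ 2 * _; set u2 := w ^+ 2 * _ => b1 b2.
have t1 : `|potential m (1 + u1) - potential m 1| < e / 2.
  apply: Hd1; rewrite (_ : 1 + u1 - 1 = u1); [lra|ring].
have t2 : `|potential m (dotp y y + u2) - potential m (dotp y y)| < e / 2.
  apply: Hd2; rewrite (_ : dotp y y + u2 - dotp y y = u2); [lra|ring].
have p10 : 0 < 1 + u1 by move: b1; rewrite ler_norml; lra.
have p20 : 0 < dotp y y + u2 by move: b2; rewrite ler_norml; lra.
have wi : 0 < w ^- 2 by rewrite invr_gt0.
rewrite !potentialM// [X in `|X|](_ : _ = powhalf m (w ^- 2) *
    (potential m (1 + u1) - potential m (dotp y y + u2))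
    + (m == 0%N)%:R * potential m (dotp y y)); last by ring.
rewrite potential1 in t1.
have -> : powhalf m (w ^- 2) = w ^+ m.
  rewrite -exprVn powhalf_sqr ?invr_eq0 ?gt_eqF// gtr0_norm ?invr_gt0//.
  by rewrite exprVn invrK.
case: (eqVneq m 0%N) => m0.
  rewrite [X in w ^+ X]m0 expr0 !mul1r.
  by move: t1 t2; rewrite !ltr_norml ler_norml; lra.
have wm0 : 0 <= w ^+ m by rewrite exprn_ge0// ltW.
rewrite mul0r addr0 normrM ger0_norm//.
have wm : w ^+ m <= w.
  by case: (m) m0 => // j _; rewrite exprS ler_piMr ?exprn_ile1// ltW.
have diff : `|potential m (1 + u1) - potential m (dotp y y + u2)| <= M.
  rewrite /M; move: t1 t2; set A := potential m (1 + u1); set B := potential m (_ + u2).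
  set C := potential m (dotp y y) => t1 t2.
  have -> : A - B = (A - 0) - (B - C) - C by ring.
  have := ler_normB ((A - 0) - (B - C)) C; have := ler_normB (A - 0) (B - C); lra.
apply: (@le_trans _ _ (w * M)).
  exact: ler_pM.
by rewrite -ler_pdivlMr//; lra.
Qed.

Lemma image_sum_diag N x : a < enorm x < 1 ->
  image_sum N x x = \sum_(i < (N + N).+1) kelvin_diag m (image_ratio N i) (enorm x)
  - \sum_(i < (N + N).+1 | i != N :> nat) scaled_diag m (image_ratio N i) (enorm x)
  + planar_coef * potential m (enorm x ^+ 2) ^+ 2.
Proof.
move=> hx; rewrite /image_sum -enorm_sqr; congr (_ - _ + _).
- apply: eq_bigr => i _; congr potential; rewrite /qform -enorm_sqr.
  by field; rewrite gt_eqF// image_ratio_gt0.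
- apply: eq_bigr => i _; congr potential; rewrite /qform -enorm_sqr.
  by field; rewrite gt_eqF// image_ratio_gt0.
- by rewrite expr2 mulrA.
Qed.

Lemma image_ratio_diag N i : 0 < image_ratio N i <= a \/ 1 <= image_ratio N i.
Proof.
case: (leqP i N) => iN; first by right; exact: image_ratio_outer.
by left; rewrite image_ratio_gt0 image_ratio_inner.
Qed.

Lemma radially_convex_image_sum N (j : nat) : (j < (N + N).+1)%N ->
  radially_convex m a 1 (fun r =>
    \sum_(i < (N + N).+1) kelvin_diag m (image_ratio N i) r
    - \sum_(i < (N + N).+1 | i != N :> nat) scaled_diag m (image_ratio N i) r
    + planar_coef * potential m (r ^+ 2) ^+ 2
    - kelvin_diag m (image_ratio N j) r).
Proof.
move=> jN; have /andP[a0 _] := a01.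
apply: (@radially_convex_eq _ _ _ _ (fun r =>
    \sum_(i < (N + N).+1 | i != Ordinal jN) kelvin_diag m (image_ratio N i) r
    + \sum_(i < (N + N).+1 | i != N :> nat) - scaled_diag m (image_ratio N i) r
    + planar_coef * potential m (r ^+ 2) ^+ 2)).
  by move=> r _; rewrite sumrN (bigD1 (Ordinal jN) (P := predT))//=; ring.
apply: radially_convexD; first apply: radially_convexD.
- apply: radially_convex_sum => i _.
  exact: (radially_convex_kelvin_diag m a01 (image_ratio_diag N i)).
- apply: radially_convex_sum => i iN.
  apply: radially_convex_opp_scaled_diag => //; first exact: image_ratio_gt0.
  have /andP[_ a1] := a01.
  case: (ltngtP i N) iN => // iN _.
    have := image_ratio_outer_lt iN; set b := image_ratio N i => h.
    by apply/eqP => b1; rewrite b1 in h; lra.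
  by have h := image_ratio_inner iN; apply/eqP => b1; rewrite b1 in h; lra.
- apply: radially_convex_sqr => //.
  by rewrite /planar_coef divr_ge0// ltW// potential_sqr_gt0.
Qed.

End Images.

(** * The Robin function *)

(** The constant [k2] undoes the normalisation [potential m 1 = 0]: it is [0] in the plane and
    [1 / (m omega)] otherwise, [omega] being the sphere area. *)
Lemma fundamental_solutionE (R : realType) m : exists k1 k2 : R, 0 < k1 /\
  forall z : 'rV[R]_m.+2, z <> 0 ->
    fundamental_solution z = k1 * potential m (dotp z z) + k2.
Proof.
case: (eqVneq m 0%N) => [->|m0].
  exists (2 * pi)^-1, 0; split; first by rewrite invr_gt0 mulr_gt0// pi_gt0.
  move=> z z0; rewrite /fundamental_solution/= /potential/= -enorm_sqr lnXn ?enorm_gt0//.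
  have pi0 : pi != 0 :> R by rewrite gt_eqF// pi_gt0.
  by rewrite addr0 -[ln _ *+ 2]mulr_natl; move: (pi : R) pi0 => p p0; field.
have w0 := unit_sphere_area_gt0 R (ltn0Sn m.+1).
have mE : m.+2%:R - 2 = m%:R :> R by rewrite -addn2 natrD addrK.
have mR : 0 < m%:R :> R by rewrite ltr0n lt0n.
pose k := (m%:R * unit_sphere_area R m.+2)^-1.
exists (k * m%:R), k; split; first by rewrite mulr_gt0// invr_gt0 mulr_gt0.
move=> z z0; have e0 := enorm_gt0 z0.
rewrite /fundamental_solution !eqSS (negbTE m0) mE -[k * _ * _]mulrA potentialE -enorm_sqr.
rewrite powhalf_sqr ?gt_eqF// gtr0_norm// invfM -/k mulrBr mulr1 subrK.
by rewrite !subSS subn0.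
Qed.

Section BoundaryGluing.
Variables (R : realType) (T : topologicalType).
Implicit Types (A S : set T) (f g h : T -> R).

(** At a boundary point the interior and boundary formulas are both compared with one function [h]
    that has the right limit from the closure. *)
Lemma within_continuous_glue A f g : open A ->
  (forall z, A z -> {for z, continuous f}) ->
  (forall z, closure A z -> ~ A z -> exists2 h,
    h x @[x --> within (closure A) (nbhs z)] --> g z &
    \forall x \near z, (A x -> f x = h x) /\ (closure A x -> ~ A x -> g x = h x)) ->
  {within closure A, continuous (fun x => if x \in A then f x else g x)}.
Proof.
move=> oA cf cg; apply/subspace_continuousP => z clAz.
have [Az|nAz] := pselect (A z).
  have E : f z = if z \in A then f z else g z by rewrite mem_set.
  have cz := cf z Az; rewrite /prop_for /continuous_at E in cz.
  apply: cvg_within_filter; apply: cvg_trans cz; apply: near_eq_cvg.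
  near=> x; have Ax : A x by near: x; exact: open_nbhs_nbhs.
  by rewrite /from_subspace mem_set.
have [h lim_h eq_h] := cg z clAz nAz.
have E : g z = if z \in A then f z else g z.
  by rewrite ifF//; apply/negbTE; rewrite notin_setE.
rewrite {}E in lim_h.
apply: cvg_trans lim_h; apply: near_eq_cvg; rewrite near_withinE.
near=> x => clAx; rewrite /from_subspace.
have [hA hN] : (A x -> f x = h x) /\ (closure A x -> ~ A x -> g x = h x) by near: x.
by case: ifPn; rewrite ?notin_setE ?inE => hx; [rewrite hA|rewrite hN].
Unshelve. all: by end_near. Qed.

Lemma cvg_within_punctured S f (y z : T) (l : R) : (\forall x \near z, x <> y) ->
  f x @[x --> within (S `\ y) (nbhs z)] --> l ->
  f x @[x --> within S (nbhs z)] --> l.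
Proof.
move=> ny lim P /lim hP.
have hP' : nbhs z [set x | (S `\ y) x -> P (f x)] by exact: hP.
suff : nbhs z [set x | S x -> P (f x)] by [].
by apply: filterS2 hP' ny => x /= hPx xy Sx; apply: hPx.
Qed.

Lemma cvg_within_at S f z : {for z, continuous f} ->
  f x @[x --> within S (nbhs z)] --> f z.
Proof. exact: cvg_within_filter. Qed.

Lemma cvg_withinB S f g (z : T) (k l : R) :
  f x @[x --> within S (nbhs z)] --> k -> g x @[x --> within S (nbhs z)] --> l ->
  f x - g x @[x --> within S (nbhs z)] --> k - l.
Proof. exact: cvgB. Qed.

Lemma cvg_withinZ S f (z : T) (c k : R) : f x @[x --> within S (nbhs z)] --> k ->
  f x * c @[x --> within S (nbhs z)] --> k * c.
Proof. by move=> hf; apply: cvgM => //; exact: cvg_cst. Qed.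

Lemma within_continuousD S f g : {within S, continuous f} ->
  (forall z, S z -> {for z, continuous g}) ->
  {within S, continuous (fun x => f x + g x)}.
Proof.
move=> /subspace_continuousP cf cg; apply/subspace_continuousP => z Sz.
by apply: cvgD; [exact: cf|apply: cvg_within_filter; exact: cg].
Qed.

End BoundaryGluing.

Lemma has_laplacian_local (R : realType) n (A : set 'rV[R]_n) u v x L :
  open A -> A x -> (forall z, A z -> u z = v z) -> has_laplacian u x L ->
  has_laplacian v x L.
Proof.
move=> oA Ax uv [l [ul <-]]; exists l; split=> // i.
have [f1 [nf f1l]] := ul i; exists f1; split=> //.
have [d /= d0 Hd] := line_near (delta_mx 0 i) oA Ax.
have uvd : \forall t \near (0 : R), `|0 - t| < d by exists d.
near=> t; have ft : is_derive (t : R) 1 (fun t => u (t *: delta_mx 0 i + x)) (f1 t).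
  by near: t.
have td : `|0 - t| < d by near: t.
apply: near_eq_is_derive ft; exists (d - `|t|) => /=.
  by rewrite subr_gt0 -[t]opprK normrN -sub0r.
move=> s /= st; apply: uv; apply: Hd => /=.
rewrite sub0r normrN -[s](subKr t); apply: le_lt_trans (ler_normB _ _) _; lra.
Unshelve. all: by end_near. Qed.

Section RobinFunction.
Variables (R : realType) (m : nat) (a : R).
Local Notation V := 'rV[R]_m.+2.
Variables (G H : V -> V -> R) (k1 k2 : R).
Hypothesis a01 : 0 < a < 1.
Hypothesis green_G : is_green_function (annulus m.+2 a) G.
Hypothesis regular_H : is_regular_part (annulus m.+2 a) G H.
Hypothesis k1_gt0 : 0 < k1.
Hypothesis fundamentalE : forall z : V, z <> 0 ->
  fundamental_solution z = k1 * potential m (dotp z z) + k2.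

Local Notation A := (annulus m.+2 a).

(* The regular part, normalised, with the boundary values forced by G = 0. *)
Let extension (y x : V) : R :=
  if x \in A then (H x y + k2) / k1 else - potential m (dotp (x - y) (x - y)).

Let extension_continuous y : A y -> {within closure A, continuous (extension y)}.
Proof.
move=> Ay; have oA : open A by exact: open_annulus.
have [fsE _ harm _] := regular_H; have [_ G0 cG] := green_G Ay.
apply: within_continuous_glue => // [z Az|z clAz nAz].
  have cH : {for z, continuous (H^~ y)}.
    by have [CH _] := harm y Ay; have [] := CH [::] isT z Az.
  apply: continuous_atM; last exact: continuous_at_cst.
  by apply: continuous_atD => //; exact: continuous_at_cst.
have zy : z <> y by move=> zy; apply: nAz; rewrite zy.
have G_boundary x : closure A x -> ~ A x -> G x y = 0.
  by move=> clAx nAx; apply: G0; split=> // /interior_subset.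
have ny : \forall x \near z, x <> y.
  apply: open_nbhs_nbhs; split=> //.
  have cy : closed [set y].
    by apply: accessible_closed_set1; apply: hausdorff_accessible; exact: norm_hausdorff.
  exact: closed_openC cy.
have cpot : {for z, continuous (fun x : V => potential m (dotp (x - y) (x - y)))}.
  rewrite (_ : (fun x => _) = scaled_term 1 y); last first.
    by apply/funext => x; rewrite potential_distE.
  apply: continuous_qform_potential; have := dotp_sub_sqr 1 1 z y.
  rewrite !scale1r /qform expr1n invr1 !mul1r mulr1 => <-.
  rewrite -enorm_sqr exprn_gt0// enorm_gt0//.
  by move/eqP; rewrite subr_eq0 => /eqP.
(* [G] is the function continuous up to the boundary, whereas nothing is known of [H] there. Near
   [z], which differs from [y], this expression agrees with both branches of [extension]. *)
exists (fun x : V => G x y / k1 - potential m (dotp (x - y) (x - y))).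
  have cGz : G x y @[x --> within (closure A `\ y) (nbhs z)] --> G z y.
    by move/subspace_continuousP: cG => /(_ z); apply.
  have := cvg_withinB (cvg_withinZ (c := k1^-1) (cvg_within_punctured ny cGz)) (cvg_within_at (closure A) cpot).
  by rewrite (G_boundary z)// mul0r sub0r.
apply: filterS ny => x xy; split=> [Ax|clAx nAx].
  rewrite fsE// fundamentalE; last by move/eqP; rewrite subr_eq0 => /eqP.
  by field; rewrite gt_eqF.
by rewrite G_boundary// mul0r sub0r.
Qed.

(** The maximum principle applies to [u = extension + image_sum] and to [- u]: the boundary value of
    [u] is zero on the outer sphere and the truncation error on the inner one. *)
Lemma regular_part_approx y e : A y -> 0 < e ->
  exists N0, forall N, (N0 <= N)%N -> forall x, A x ->
    `|- (H x y + k2) / k1 - image_sum a N y x| <= e.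
Proof.
move=> Ay e0; have [N0 HN0] := image_sum_inner_error a01 Ay e0.
exists N0 => N /HN0 err x Ax; have [_ _ harm _] := regular_H.
have oA : open A by exact: open_annulus.
have cA : compact (closure A) by exact: compact_closure_annulus.
have clA z : closure A z -> a <= enorm z <= 1 by move/closure_annulus_sub.
pose u z := extension y z + image_sum a N y z.
have uA z : A z -> u z = (H z y + k2) / k1 + image_sum a N y z.
  by move=> Az; rewrite /u /extension mem_set.
have hu z : A z -> has_laplacian u z 0.
  move=> Az; have az := clA z (subset_closure Az).
  have h1 := has_laplacianD (harmonic_has_laplacian oA (harm y Ay) Az)
    (has_laplacian_cst k2 z).
  have := has_laplacianD (has_laplacianZ k1^-1 h1) (has_laplacian_image_sum a01 N Ay az).
  rewrite !addr0 mulr0; apply: has_laplacian_local oA Az _ => w Aw.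
  by rewrite uA// mulrC.
have cu : {within closure A, continuous u}.
  apply: within_continuousD; first exact: extension_continuous.
  by move=> z clz; apply: continuous_image_sum => //; exact: clA.
have bu z : closure A z -> ~ A z -> `|u z| <= e.
  move=> clz nAz; have -> : u z = image_sum a N y z - potential m (dotp (z - y) (z - y)).
    by rewrite /u /extension ifF 1?addrC//; apply/negbTE; rewrite notin_setE.
  case: (boundary_annulus (conj clz nAz)) => [za|z1]; first exact: err.
  by rewrite image_sum_outer// subrr normr0 ltW.
have up : u x <= e.
  apply: maximum_principle oA cA cu hu _ _ Ax => z clz nAz.
  by apply: le_trans (bu z clz nAz); exact: ler_norm.
have down : -1 * u x <= e.
  apply: (@maximum_principle R m.+1 A (fun z => -1 * u z)) => //.
  - move=> z; apply: cvgM; first exact: cvg_cst.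
    exact: cu.
  - by move=> z Az; have := has_laplacianZ (-1) (hu z Az); rewrite mulr0.
  - move=> z clz nAz; rewrite mulN1r.
    by apply: le_trans (bu z clz nAz); rewrite -normrN; exact: ler_norm.
rewrite mulNr -opprD normrN -uA// ler_norml; lra.
Qed.

Let unit_vector : V := delta_mx 0 0.

Let rho (r : R) : R := H (r *: unit_vector) (r *: unit_vector).

Let enorm_unit r : 0 < r -> enorm (r *: unit_vector) = r.
Proof.
move=> r0; apply/eqP; rewrite -(@eqrXn2 _ 2)// ?enorm_ge0 ?ltW//.
by rewrite enorm_sqr dotpZl dotpZr dotp_delta mxE !eqxx mulr1 -expr2.
Qed.

Let unit_in r : a < r < 1 -> A (r *: unit_vector).
Proof.
have /andP[a0 _] := a01; move=> /andP[ar r1].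
by rewrite /annulus/= enorm_unit ?ar ?r1//; exact: lt_trans ar.
Qed.

Let diag_sum N (r : R) : R :=
  \sum_(i < (N + N).+1) kelvin_diag m (image_ratio a N i) r
  - \sum_(i < (N + N).+1 | i != N :> nat) scaled_diag m (image_ratio a N i) r
  + planar_coef m a * potential m (r ^+ 2) ^+ 2.

Let robin_approx x e : A x -> 0 < e ->
  exists N0, forall N, (N0 <= N)%N -> `|- (H x x + k2) / k1 - diag_sum N (enorm x)| <= e.
Proof.
move=> Ax e0; have [N0 HN0] := regular_part_approx Ax e0.
by exists N0 => N /HN0/(_ x Ax); rewrite (image_sum_diag a01).
Qed.

(** Both sides are limits of the same numbers, since [diag_sum] depends on [x] only through
    [enorm x]; no rotation invariance of [G] or [H] is invoked. *)
Let robin_radial x : A x -> robin H x = rho (enorm x).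
Proof.
move=> Ax; have /andP[a0 _] := a01; have xA := Ax; rewrite /annulus/= in xA.
have x0 : 0 < enorm x by case/andP: xA => + _; exact: lt_trans.
apply/eqP; rewrite -subr_eq0 -normr_eq0; apply/eqP.
apply/le_anti; rewrite normr_ge0 andbT; apply/ler_addgt0Pr => e e0; rewrite add0r.
pose d := e / (2 * k1); have d0 : 0 < d by rewrite divr_gt0// mulr_gt0.
have [N1 H1] := robin_approx Ax d0.
have [N2 H2] := robin_approx (unit_in xA) d0; rewrite enorm_unit// in H2.
move: (H1 (N1 + N2)%N (leq_addr _ _)) (H2 (N1 + N2)%N (leq_addl _ _)).
rewrite -/(rho (enorm x)) -/(robin H x); set D := diag_sum _ _ => h1 h2.
have -> : robin H x - rho (enorm x) = k1 *
    ((- (rho (enorm x) + k2) / k1 - D) - (- (robin H x + k2) / k1 - D)).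
  by field; rewrite gt_eqF.
rewrite normrM gtr0_norm//; apply: (@le_trans _ _ (k1 * (d + d))).
  by rewrite ler_pM2l//; apply: le_trans (ler_normB _ _) _; rewrite lerD.
by rewrite (_ : k1 * (d + d) = e)// /d; field; rewrite gt_eqF.
Qed.

Let diag_vector : V * V := (unit_vector, unit_vector).

(** Along the diagonal ray, differentiating [rho] means differentiating [H] jointly in the direction
    [(e, e)]; joint smoothness on the product supplies the iterated derivatives. *)
Let diag_smooth (s : seq (V * V)) (r : R) : a < r < 1 ->
  is_derive r 1
    (fun t => iter_derive s (fun p : V * V => H p.1 p.2) (t *: diag_vector + 0))
    (iter_derive (diag_vector :: s) (fun p => H p.1 p.2) (r *: diag_vector + 0)).
Proof.
move=> hr; have [_ smooth_H _ _] := regular_H.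
apply: is_derive_line; apply/derivableP.
have AA : (A `*` A) (r *: diag_vector + 0).
  by rewrite addr0; split; exact: unit_in.
have [_] := smooth_H (size s).+1 s (leqnSn _) _ AA.
by apply.
Qed.

Lemma robin_profile : exists rho : R -> R,
    [/\ forall x, A x -> robin H x = rho (enorm x),
        forall r : R, a < r < 1 -> derivable rho r 1
      & exists r0 : R,
          [/\ a < r0 < 1 /\ rho^`() r0 = 0,
              forall r : R, a < r < 1 -> rho^`() r = 0 -> r = r0,
              derivable rho^`() r0 1
            & rho^`(2) r0 < 0]].
Proof.
pose F (p : V * V) := H p.1 p.2; pose w := diag_vector.
pose d1 (r : R) : R := iter_derive [:: w] F (r *: w + 0).
pose d2 (r : R) : R := iter_derive [:: w; w] F (r *: w + 0).
have rho1 r : a < r < 1 -> is_derive r 1 rho (d1 r).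
  move=> hr; have := diag_smooth [::] hr.
  by rewrite (_ : (fun t => _) = rho)//; apply/funext => t; rewrite addr0.
have rho2 r : a < r < 1 -> is_derive r 1 d1 (d2 r).
  by move=> hr; have h := diag_smooth [:: w] hr; exact: h.
pose f r := - (rho r + k2) / k1.
have fE r : a < r < 1 -> is_derive r 1 f (- d1 r / k1).
  move=> hr; have h := is_derive_addf (rho1 r hr) (is_derive_cstf k2 r).
  apply: is_derive_eq (is_derive_mulf (is_derive_oppf h) (is_derive_cstf k1^-1 r)) _.
  by rewrite /=; ring.
have dfE r : a < r < 1 -> is_derive r 1 (fun t => - d1 t / k1) (- d2 r / k1).
  move=> hr; apply: is_derive_eq
    (is_derive_mulf (is_derive_oppf (rho2 r hr)) (is_derive_cstf k1^-1 r)) _.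
  by rewrite /=; ring.
have /andP[a0 a1] := a01.
(* The index [j N] locates the image of ratio [q] in the sum of order [N]: it is [N] for [q = 1] and
   [N + 1] for [q = a], the latter being in range only when [N > 0]. *)
have convex q (j : nat -> nat) :
    (forall N, (0 < N)%N -> (j N < (N + N).+1)%N /\ image_ratio a N (j N) = q) ->
    radially_convex m a 1 (fun r => f r - kelvin_diag m q r).
  move=> jq; apply: (radially_convex_lim a0
      (v := fun N r => diag_sum N r - kelvin_diag m (image_ratio a N (j N)) r)).
    by move=> N /jq[jN _]; exact: radially_convex_image_sum.
  move=> r e hr e0; have [N0 HN0] := robin_approx (unit_in hr) e0.
  exists N0.+1 => N N0N; have [_ ->] := jq N (leq_trans (ltn0Sn _) N0N).
  have := HN0 N (ltnW N0N); rewrite enorm_unit; last by lra.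
  by rewrite opprB addrA subrK.
have convex_outer : radially_convex m a 1 (fun r => f r - kelvin_diag m 1 r).
  apply: (convex 1 (fun N => N)) => N N0.
  by rewrite (image_ratioN a01) ltnS leq_addr.
have convex_inner : radially_convex m a 1 (fun r => f r - kelvin_diag m a r).
  apply: (convex a (fun N => N.+1)) => N N0.
  by rewrite image_ratioS (image_ratioN a01) mulr1 !ltnS -[X in (X < _)%N]addn0 ltn_add2l.
have [r0 [hr0 c0 uniq0 pos0]] :=
  radial_critical_point a01 fE dfE convex_outer convex_inner.
have rho'E r : a < r < 1 -> rho^`() r = d1 r.
  by move=> hr; rewrite derive1E; have [_ ->] := rho1 r hr.
(* [rho] is controlled only for radii in []a, 1[], so its derivative is identified with [d1] near
   [r0] before differentiating again. *)
have near_rho' : \near r0, d1 r0 = rho^`() r0.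
  have : open [set r : R | a < r < 1].
    rewrite (_ : [set r : R | _] = `]a, 1[%classic); first exact: itv_open.
    by apply/seteqP; split => r /=; rewrite in_itv.
  move=> oI; apply: filterS (open_nbhs_nbhs (conj oI hr0)) => r /= hr.
  by rewrite rho'E.
have rho''E : is_derive r0 1 rho^`() (d2 r0).
  exact: near_eq_is_derive near_rho' (rho2 r0 hr0).
exists rho; split.
- exact: robin_radial.
- by move=> r /rho1[].
- exists r0; split.
  + split=> //; rewrite rho'E//.
    by move/eqP: c0; rewrite mulf_eq0 invr_eq0 (gt_eqF k1_gt0) orbF oppr_eq0 => /eqP.
  + move=> r hr; rewrite rho'E// => dr; apply: uniq0 => //.
    by rewrite dr oppr0 mul0r.
  + by case: rho''E.
  + rewrite derive1nS derive1n1 derive1E; case: rho''E => _ ->.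
    by move: pos0; rewrite pmulr_lgt0 ?invr_gt0// oppr_gt0.
Qed.

End RobinFunction.

Theorem theorem1p3 (R : realType) (n : nat) (a : R)
    (G H : 'rV[R]_n -> 'rV[R]_n -> R) :
  (2 <= n)%N -> 0 < a < 1 ->
  is_green_function (annulus n a) G ->
  is_regular_part (annulus n a) G H ->
  exists rho : R -> R,
    [/\ forall x, annulus n a x -> robin H x = rho (enorm x),
        forall r : R, a < r < 1 -> derivable rho r 1
      & exists r0 : R,
          [/\ a < r0 < 1 /\ rho^`() r0 = 0,
              forall r : R, a < r < 1 -> rho^`() r = 0 -> r = r0,
              derivable rho^`() r0 1
            & rho^`(2) r0 < 0]].
Proof.
case: n G H => [|[|m]]// G H _ a01 green_G regular_H.
have [k1 [k2 [k1_gt0 fsE]]] := fundamental_solutionE R m.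
exact: robin_profile a01 green_G regular_H k1_gt0 fsE.
Qed.
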